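(* Let $(C,\beta,(x_i))$ be a pointed vortex loop in $\mathbb R^2$ with $k$ attached points $x_1,\dots,x_k\in C$ carrying non-zero point vorticities $\Gamma_1,\dots,\Gamma_k\in\mathbb R$, regarded as the element of $\mathfrak g^*$ given by $\langle(C,\beta,(x_i)),X_h\rangle=\int_C h\beta+\sum_{i=1}^k\Gamma_i h(x_i)$. Then the group $G_C=\{\varphi\in\mathrm{Ham}_c(\mathbb R^2):\varphi(C)=C\}$ of Hamiltonian diffeomorphisms that preserve the curve $C$ is a polarization subgroup of $G=\mathrm{Ham}_c(\mathbb R^2)$ for the coadjoint orbit of $(C,\beta,(x_i))\in\mathfrak g^*$.
   Context: $\omega$ is the canonical area form on $\mathbb R^2$. $G=\mathrm{Ham}_c(\mathbb R^2)$ is the group of compactly supported Hamiltonian diffeomorphisms of $\mathbb R^2$, with Lie algebra $\mathfrak g$ of compactly supported Hamiltonian vector fields $X_h$, $i_{X_h}\omega=dh$, identified with $C_c^\infty(\mathbb R^2)$ by $X_h\leftrightarrow h$; the bracket (minus the usual bracket of vector fields) is such that $[X_{h_1},X_{h_2}]$ has Hamiltonian function $\omega(X_{h_1},X_{h_2})$. $\mathfrak g^*$ is the space of distributions $C_c^\infty(\mathbb R^2)^*$. A vortex loop is a pair $(C,\beta)$ with $C$ a smooth closed embedded curve in $\mathbb R^2$ and $\beta\in\Omega^1(C)$ nowhere zero (a volume form on $C$). A pointed vortex loop $(C,\beta,(x_i))$ is a vortex loop together with $k$ distinct points $x_1,\dots,x_k\in C$, consecutive with respect to the orientation of $C$ induced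 by $\beta$. Polarization subgroup for the coadjoint orbit of $\alpha\in\mathfrak g^*$: a subgroup $H\subset G$ whose Lie algebra $\mathfrak h\subset\mathfrak g$ satisfies the polarization condition $\langle\alpha,[X,Y]\rangle=0$ for all $X,Y\in\mathfrak h$ and is maximal among the Lie subalgebras of $\mathfrak g$ satisfying this condition. The Lie algebra $\mathfrak g_C$ of $G_C$ is the Lie algebra of compactly supported Hamiltonian vector fields on $\mathbb R^2$ that are tangent to $C$. *)

(* Defs.v *)
From HB Require Import structures.
From mathcomp Require Import all_boot all_order all_algebra.
From mathcomp Require Import all_classical all_reals all_analysis.
Set Implicit Arguments.
Unset Strict Implicit.
Unset Printing Implicit Defensive.
Import Order.TTheory GRing.Theory Num.Theory.
Import numFieldNormedType.Exports.
Local Open Scope classical_set_scope.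
Local Open Scope ring_scope.

Section Smooth.
Context {R : realType} {V W : normedModType R}.

Fixpoint Ck (n : nat) (f : V -> W) : Prop :=
  if n is m.+1 then
    (forall x, differentiable f x) /\ (forall v, Ck m (fun x => 'D_v f x))
  else continuous f.

Definition smooth (f : V -> W) : Prop := forall n, Ck n f.

Lemma smooth_continuous f : smooth f -> continuous f.
Proof. by move=> /(_ 0%N). Qed.

End Smooth.

Notation plane R := (R * R)%type.

Section Hamiltonian.
Context {R : realType}.
Implicit Types (p v w : plane R) (f g h : plane R -> R).
Implicit Types (phi psi : plane R -> plane R).

Definition ex : plane R := (1, 0).
Definition ey : plane R := (0, 1).

Definition omega v w : R := v.1 * w.2 - v.2 * w.1.

Definition ham_vf h : plane R -> plane R :=
  fun p => ('D_ey h p, - 'D_ex h p).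

Lemma omega_ham_vf h p v :
  differentiable h p -> omega (ham_vf h p) v = 'd h p v.
Proof.
move=> dh; have -> : 'd h p v = 'd h p (v.1 *: ex + v.2 *: ey).
  congr ('d h p _); rewrite [LHS]surjective_pairing; congr pair => /=.
    by rewrite [_ *: 1]mulr1 [_ *: 0]mulr0 addr0.
  by rewrite [_ *: 1]mulr1 [_ *: 0]mulr0 add0r.
rewrite linearD !linearZ /= /omega /ham_vf /= !deriveE//.
by rewrite mulNr opprK addrC [_ * v.1]mulrC [_ * v.2]mulrC.
Qed.

(* An element X_h of the Lie algebra is represented by its Hamiltonian
   function h, so subspaces of the Lie algebra are sets of test functions. *)
Definition test_function : set (plane R -> R) :=
  [set h | smooth h /\ compact (closure [set p | h p != 0])].

Definition bracket g h : plane R -> R :=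
  fun p => omega (ham_vf g p) (ham_vf h p).

Record lie_subalgebra (k : set (plane R -> R)) : Prop := LieSubalgebra {
  lie_sub : k `<=` test_function;
  lie_zero : k (fun=> 0);
  lie_linear : forall (a : R) g h, k g -> k h -> k (fun p => a * g p + h p);
  lie_bracket : forall g h, k g -> k h -> k (bracket g h) }.

Definition partial_xy (i j : nat) h : plane R -> R :=
  iter i (fun f => fun p => 'D_ex f p) (iter j (fun f => fun p => 'D_ey f p) h).

(* Values on functions that are not test functions are irrelevant. *)
Record distribution := Distribution {
  distr_ev :> (plane R -> R) -> R;
  distr_linear : forall (a : R) g h, test_function g -> test_function h ->
    distr_ev (fun p => a * g p + h p) = a * distr_ev g + distr_ev h;
  distr_continuous : forall K : set (plane R), compact K ->
    exists (N : nat) (A : R), forall h, test_function h ->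
      (forall p, ~ K p -> h p = 0) ->
      forall M : R,
        (forall i j p, (i + j <= N)%N -> `|partial_xy i j h p| <= M) ->
        `|distr_ev h| <= A * M }.

(* Time runs over the whole line, with a support bound uniform in time. This
   gives the same time-one maps as time in [0, 1]: reparametrize time by a
   smooth function that is constant near each end and beyond. *)
Record ham_isotopy (phi : R -> plane R -> plane R) (H : R -> plane R -> R)
    : Prop := HamIsotopy {
  ham_iso_smooth : smooth (fun z : R * plane R => phi z.1 z.2);
  ham_iso_inverse : exists psi : R -> plane R -> plane R,
    smooth (fun z : R * plane R => psi z.1 z.2) /\
    forall t, cancel (phi t) (psi t) /\ cancel (psi t) (phi t);
  ham_iso_start : phi 0 = id;
  ham_iso_fun_smooth : smooth (fun z : R * plane R => H z.1 z.2);
  ham_iso_support : exists2 K : set (plane R), compact K &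
    forall t p, ~ K p -> H t p = 0;
  ham_iso_flow : forall (t : R) p,
    is_derive t (1 : R) (fun s : R => phi s p) (ham_vf (H t) (phi t p)) }.

Definition Ham_c : set (plane R -> plane R) :=
  [set phi | exists Phi H, ham_isotopy Phi H /\ Phi 1 = phi].

Record subgroup_of_Ham_c (G : set (plane R -> plane R)) : Prop :=
  SubgroupOfHamc {
  subgroup_sub : G `<=` Ham_c;
  subgroup_id : G id;
  subgroup_comp : forall phi psi, G phi -> G psi -> G (phi \o psi);
  subgroup_inv : forall phi, G phi ->
    exists2 psi, G psi & cancel phi psi /\ cancel psi phi }.

(* The initial velocities of smooth curves in G starting at the identity; the
   support condition is part of smoothness of a curve of compactly supported
   diffeomorphisms. *)
Definition lie_algebra_of (G : set (plane R -> plane R))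
    : set (plane R -> R) :=
  [set h | test_function h /\
    exists c : R -> plane R -> plane R,
    [/\ smooth (fun z : R * plane R => c z.1 z.2),
        forall t, G (c t),
        forall T : R, exists2 K : set (plane R), compact K &
          forall t p, `|t| <= T -> ~ K p -> c t p = p,
        c 0 = id &
        forall p, is_derive (0 : R) (1 : R) (fun t : R => c t p) (ham_vf h p)]].

Definition polarizing (alpha : distribution) (k : set (plane R -> R)) : Prop :=
  forall g h, k g -> k h -> alpha (bracket g h) = 0.

Record polarization_subgroup (alpha : distribution)
    (G : set (plane R -> plane R)) : Prop := PolarizationSubgroup {
  pol_subgroup : subgroup_of_Ham_c G;
  pol_lie : lie_subalgebra (lie_algebra_of G);
  pol_polarizing : polarizing alpha (lie_algebra_of G);
  pol_maximal : forall k : set (plane R -> R),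
    lie_subalgebra k -> polarizing alpha k ->
    lie_algebra_of G `<=` k -> k = lie_algebra_of G }.

Definition curve_stabilizer (C : set (plane R)) : set (plane R -> plane R) :=
  [set phi | Ham_c phi /\ phi @` C = C].

End Hamiltonian.

Section VortexLoops.
Context {R : realType}.
Implicit Types (C : set (plane R)) (c : R -> plane R) (p v w : plane R).

(* A diffeomorphism from R/Z onto C, as a 1-periodic map. *)
Record loop_param C c : Prop := LoopParam {
  param_smooth : smooth c;
  param_periodic : forall t, c (t + 1) = c t;
  param_inj : forall s t : R, 0 <= s < 1 -> 0 <= t < 1 -> c s = c t -> s = t;
  param_immersion : forall t, derive1 c t != 0;
  param_range : range c = C }.

Definition embedded_loop C : Prop := exists c, loop_param C c.

Definition tangent C p v : Prop :=
  exists c, [/\ smooth c, range c `<=` C, c 0 = p & derive1 c 0 = v].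

(* A one-form on C is represented by [beta p v], of which only the values at
   p in C and v in T_p C are relevant. *)
Record one_form C (beta : plane R -> plane R -> R) : Prop := OneForm {
  form_linear : forall p (a : R) v w, tangent C p v -> tangent C p w ->
    beta p (a *: v + w) = a * beta p v + beta p w;
  form_smooth : forall c, smooth c -> range c `<=` C ->
    smooth (fun t => beta (c t) (derive1 c t)) }.

Definition nowhere_zero C (beta : plane R -> plane R -> R) : Prop :=
  forall p, C p -> exists2 v, tangent C p v & beta p v != 0.

Definition oriented_param C (beta : plane R -> plane R -> R) c : Prop :=
  loop_param C c /\ forall t, 0 < beta (c t) (derive1 c t).

Record vortex_loop := VortexLoop {
  vl_curve :> set (plane R);
  vl_form : plane R -> plane R -> R;
  vl_embedded : embedded_loop vl_curve;
  vl_one_form : one_form vl_curve vl_form;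
  vl_volume : nowhere_zero vl_curve vl_form }.

(* The points are met in this order during one turn around C, hence they are
   distinct. *)
Definition consecutive (L : vortex_loop) (k : nat) (x : 'I_k -> plane R)
    : Prop :=
  exists c (t : 'I_k -> R),
  [/\ oriented_param L (vl_form L) c,
      forall i, x i = c (t i),
      forall i j : 'I_k, (i < j)%N -> t i < t j &
      forall i j : 'I_k, t j < t i + 1].

Record pointed_vortex_loop (k : nat) := PointedVortexLoop {
  pvl_loop :> vortex_loop;
  pvl_point : 'I_k -> plane R;
  pvl_consecutive : consecutive pvl_loop pvl_point }.

Definition some_oriented_param (L : vortex_loop) : R -> plane R :=
  xget (fun=> 0) (oriented_param L (vl_form L)).

(* The integral over the curve oriented by its form. It does not depend on the
   choice of the oriented parametrization. *)
Definition loop_integral (L : vortex_loop) (h : plane R -> R) : R :=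
  let c := some_oriented_param L in
  \int[lebesgue_measure]_(t in `[0, 1]) (h (c t) * vl_form L (c t) (derive1 c t)).

Lemma loop_integrable (L : vortex_loop) (c : R -> plane R) (h : plane R -> R) :
  oriented_param L (vl_form L) c -> continuous h ->
  (@lebesgue_measure R).-integrable `[0, 1]
    (EFin \o (fun t => h (c t) * vl_form L (c t) (derive1 c t))).
Proof.
move=> [[c_smooth _ _ _ c_range] _] h_cont.
have form_cont : continuous (fun t => vl_form L (c t) (derive1 c t)).
  apply: smooth_continuous; apply: form_smooth c_smooth _.
    exact: vl_one_form.
  by rewrite -c_range.
have hc_cont : continuous (h \o c).
  move=> t; apply: continuous_comp; last exact: h_cont.
  exact: smooth_continuous c_smooth t.
apply: continuous_compact_integrable; first exact: segment_compact.
apply: continuous_subspaceT => t.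
exact: (cvgM (hc_cont t) (form_cont t)).
Qed.

Section Pairing.
Context {k : nat} (P : pointed_vortex_loop k) (Gamma : 'I_k -> R).

Definition pvl_pairing (h : plane R -> R) : R :=
  loop_integral P h + \sum_(i < k) Gamma i * h (pvl_point P i).

Lemma some_oriented_paramP : oriented_param P (vl_form P) (some_oriented_param P).
Proof. by apply: xgetPex; have [c [t []]] := pvl_consecutive P; exists c. Qed.

Lemma pvl_pairing_linear (a : R) g h : test_function g -> test_function h ->
  pvl_pairing (fun p => a * g p + h p) = a * pvl_pairing g + pvl_pairing h.
Proof.
move=> [/smooth_continuous g_cont _] [/smooth_continuous h_cont _].
have gi := loop_integrable some_oriented_paramP g_cont.
have hi := loop_integrable some_oriented_paramP h_cont.
rewrite /pvl_pairing /loop_integral.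
set c := some_oriented_param P in gi hi *.
rewrite mulrDr mulr_sumr addrACA -big_split/=; congr (_ + _); last first.
  by apply: eq_bigr => i _; rewrite mulrDr mulrCA.
rewrite -RintegralZl// -RintegralD//; last first.
  exact: (integrableZl _ a gi).
by apply: eq_Rintegral => t _; rewrite mulrDl mulrA.
Qed.

Lemma pvl_pairing_continuous (K : set (plane R)) : compact K ->
  exists (N : nat) (A : R), forall h, test_function h ->
    (forall p, ~ K p -> h p = 0) ->
    forall M : R,
      (forall i j p, (i + j <= N)%N -> `|partial_xy i j h p| <= M) ->
      `|pvl_pairing h| <= A * M.
Proof.
move=> _; have i1 := loop_integrable some_oriented_paramP (@cst_continuous _ _ (1 : R)).
exists 0%N, (loop_integral P (fun=> 1) + \sum_(i < k) `|Gamma i|).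
move=> h [/smooth_continuous h_cont _] _ M hM.
have {}hM p : `|h p| <= M by exact: (hM 0%N 0%N p).
have hi := loop_integrable some_oriented_paramP h_cont.
rewrite /pvl_pairing (le_trans (ler_normD _ _))// mulrDl lerD//; last first.
  rewrite (le_trans (ler_norm_sum _ _ _))// mulr_suml ler_sum// => i _.
  by rewrite normrM ler_wpM2l.
rewrite /loop_integral in i1 hi *; set c := some_oriented_param P in i1 hi *.
have [_ c_pos] := some_oriented_paramP.
rewrite (le_trans (le_normr_Rintegral _ _))// -RintegralZr//.
apply: le_Rintegral => //.
- exact: (integrable_norm hi).
- exact: (integrableZr _ M i1).
- move=> t _; rewrite mul1r normrM (gtr0_norm (c_pos t)) mulrC.
  by rewrite ler_wpM2l// ltW.
Qed.

Definition pvl_distribution : distribution :=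
  Distribution pvl_pairing_linear pvl_pairing_continuous.

End Pairing.

End VortexLoops.
Arguments vortex_loop R : clear implicits.
Arguments pointed_vortex_loop R k : clear implicits.

(* Main.v *)
(* The Lie algebra of the stabilizer of C consists of the test functions that
   are constant on C.  Such a constancy is necessary: a smooth curve inside C has
   velocity tangent to C, because short chords of C are almost parallel to the
   tangent.  Conversely, no flow is integrated.  Since curves of diffeomorphisms
   can be multiplied, a partition of unity reduces the problem to functions S
   that are either critical along C, or supported in a symplectic chart in which
   C is the line y = 0 and vanishing on that line.  The equations
     y = Y + k S_x(x, Y),  X = x + k S_Y(x, Y)
   of the mixed generating function x Y + k S define, for small k = k(t), a
   Hamiltonian isotopy (x, y) |-> (X, Y) with Hamiltonian k'(t) S(x, Y), which
   fixes the critical points of S and preserves the line if S vanishes on it.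

   The bracket of two functions constant on C vanishes on C: this is the
   polarization condition.  For maximality, let h be non-constant on C, y a local
   defining function of C, b >= 0 a bump function and m >= 0 a function vanishing
   exactly at the marked points.  Then f = b m {h, y} y vanishes on C, and
   {h, f} = b m {h, y}^2 on C, so that the pairing with {h, f} is the integral of
   a nonzero nonnegative density. *)
From HB Require Import structures.
Require Import Defs.
From mathcomp Require Import all_boot all_order all_algebra.
From mathcomp Require Import all_classical all_reals all_analysis.
From mathcomp Require Import ring lra zify.
Set Implicit Arguments.
Unset Strict Implicit.
Unset Printing Implicit Defensive.
Import Order.TTheory GRing.Theory Num.Theory.
Import numFieldNormedType.Exports.
Local Open Scope classical_set_scope.
Local Open Scope ring_scope.

(** * Calculus of smooth maps between normed spaces *)

Section SmoothCalculus.
Context {R : realType}.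
Implicit Types U V W : normedModType R.

(** All constructions are global, so that a single analytic tool suffices: an implicit function
    theorem on a whole product, under the uniform lower bound 1/2 on the partial derivative to be
    inverted. This explains the factor k(t): it keeps |k S_xy| at most 1/2 at all times, and since
    the Lie algebra sees only initial velocities, k(0) = 0 and k'(0) = 1 are enough besides this
    bound. The charts are symplectic diffeomorphisms of the entire plane, composed of a shear along
    a graph and a linear frame, because conjugation by such a map carries compactly supported
    Hamiltonian isotopies to isotopies of the same kind. The price is that the image of C is a line
    only near one point. Elsewhere it is arbitrary, and it is preserved because the generated map
    fixes every critical point of S. In the maximality argument the weight m is there for the point
    vorticities: their signs are arbitrary, and their contributions could cancel the integral. *)

Lemma Ck_isdiff V W n (f : V -> W) (df : V -> V -> W) :
  (forall x, is_diff x f (df x)) -> (forall v, Ck n (df ^~ v)) -> Ck n.+1 f.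
Proof.
move=> fdf Cdf; split=> [x|v]; first by case: (fdf x).
(* [Ck] iterates derivatives in fixed directions, so [df] is frozen at [v] and inductions run on
   functions of the point alone. *)
suff -> : (fun x => 'D_v f x) = df ^~ v by [].
by apply/funext => x; have [d <-] := fdf x; rewrite deriveE.
Qed.

Lemma CkW V W n (f : V -> W) : Ck n.+1 f -> Ck n f.
Proof.
elim: n f => [|n IH] f [df Cf]; first by move=> x;
  apply: differentiable_continuous.
by split=> // v; apply: IH; exact: Cf.
Qed.

Lemma Ck_cst V W n (a : W) : Ck n (fun _ : V => a).
Proof.
elim: n a => [|n IH] a; first by move=> x; exact: cvg_cst.
by apply: (@Ck_isdiff _ _ _ _ (fun _ _ => 0)) => v; exact: IH.
Qed.

Lemma is_diff_lin V W (l : {linear V -> W}) x : continuous l -> is_diff x l l.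
Proof. by move=> lc; split; [exact: linear_differentiable|exact: diff_lin]. Qed.

Lemma Ck_lin V W n (l : {linear V -> W}) : continuous l -> Ck n l.
Proof.
move=> lc; case: n => // n; apply: (@Ck_isdiff _ _ _ _ (fun=> l)) => [x|v].
  exact: is_diff_lin.
exact: Ck_cst.
Qed.

Lemma Ck_linear_comp U V W n (l : {linear V -> W}) (f : U -> V) :
  continuous l -> Ck n f -> Ck n (l \o f).
Proof.
move=> lc; elim: n f => [|n IH] f.
  by move=> fc x; apply: continuous_comp; [exact: fc|exact: lc].
move=> [df Cf]; apply: (@Ck_isdiff _ _ _ _ (fun x v => l ('D_v f x))) => [x|v].
  have -> : (fun v => l ('D_v f x)) = l \o 'd f x.
    by apply/funext => v /=; rewrite deriveE.
  apply: is_diff_comp; [exact: differentiableP|exact: is_diff_lin].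
by apply: IH; exact: Cf.
Qed.

Lemma Ck_add V W n (f g : V -> W) : Ck n f -> Ck n g ->
  Ck n (fun x => f x + g x).
Proof.
elim: n f g => [|n IH] f g.
  by move=> fc gc x; apply: continuousD; [exact: fc|exact: gc].
move=> [df Cf] [dg Cg].
apply: (@Ck_isdiff _ _ _ _ (fun x v => 'D_v f x + 'D_v g x)) => [x|v];
  last by apply: IH; [exact: Cf|exact: Cg].
have -> : (fun v => 'D_v f x + 'D_v g x) = ('d f x : V -> W) +
  ('d g x : V -> W).
  by apply/funext => v /=; rewrite !deriveE.
by apply: is_diffD; exact: differentiableP.
Qed.

Lemma Ck_mul V n (f g : V -> R) : Ck n f -> Ck n g -> Ck n (fun x => f x * g x).
Proof.
elim: n f g => [|n IH] f g.
  by move=> fc gc x; apply: continuousM; [exact: fc|exact: gc].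
move=> Cf1 Cg1; have Cf0 := CkW Cf1; have Cg0 := CkW Cg1.
move: Cf1 Cg1 => [df Cf] [dg Cg].
apply: (@Ck_isdiff _ _ _ _ (fun x v => f x * 'D_v g x + g x * 'D_v f x)) =>
  [x|v].
  have -> : (fun v => f x * 'D_v g x + g x * 'D_v f x) = f x *:
    ('d g x : V -> R) + g x *: ('d f x : V -> R).
    by apply/funext => v /=; rewrite !deriveE.
  by apply: is_diffM; exact: differentiableP.
by apply: Ck_add; apply: IH => //; [exact: Cg|exact: Cf].
Qed.

Lemma Ck_pair U V W n (f : U -> V) (g : U -> W) :
  Ck n f -> Ck n g -> Ck n (fun x => (f x, g x)).
Proof.
elim: n f g => [|n IH] f g.
  by move=> fc gc x; apply: cvg_pair; [exact: fc|exact: gc].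
move=> [df Cf] [dg Cg].
apply: (@Ck_isdiff _ _ _ _ (fun x v => ('D_v f x, 'D_v g x))) => [x|v];
  last by apply: IH; [exact: Cf|exact: Cg].
have -> : (fun v => ('D_v f x, 'D_v g x)) = (fun v => ('d f x v, 'd g x v)).
  by apply/funext => v /=; rewrite !deriveE.
by apply: is_diff_pair; exact: differentiableP.
Qed.

(** The derivative of 1/f is built from f' and 1/f itself, so the regularity of 1/f bootstraps with
    f fixed. *)
Lemma Ck_inv V n (f : V -> R) : (forall x, f x != 0) -> Ck n f ->
  Ck n (fun x => (f x)^-1).
Proof.
move=> f0; elim: n => [|n IH].
  by move=> fc x; apply: continuousV => //; exact: fc.
move=> Cf1; have Cf0 := CkW Cf1; have {}IH := IH Cf0; move: Cf1 => [df Cf].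
apply: (@Ck_isdiff _ _ _ _ (fun x v => ((-1) * ((f x)^-1 * (f x)^-1)) * 'D_v f
  x)) => [x|v].
  split; first exact: differentiableV.
  rewrite diffV //; apply/funext => v /=; rewrite deriveE //.
  by rewrite /GRing.scale /= -invfM -expr2 mulN1r.
apply: Ck_mul; last exact: Cf.
by apply: Ck_mul; [exact: Ck_cst|exact: Ck_mul].
Qed.



(* A finite basis with continuous coordinates: what is needed to express the
   differential of a composite through directional derivatives. *)
Definition fin_basis V := exists (I : finType) (e : I -> V) (l : I ->
  {linear V -> R}),
  (forall i, continuous (l i)) /\ forall v, v = \sum_i l i v *: e i.

Lemma Ck_sum V n (I : Type) (r : seq I) (f : I -> V -> R) :
  (forall i, Ck n (f i)) ->
  Ck n (fun x => \sum_(i <- r) f i x).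
Proof.
move=> Cf; elim: r => [|i r IH].
  have -> : (fun x => \sum_(i <- [::]) f i x) = (fun=> 0).
    by apply/funext => x; rewrite big_nil.
  exact: Ck_cst.
have -> : (fun x => \sum_(j <- i :: r) f j x) =
    (fun x => f i x + \sum_(j <- r) f j x).
  by apply/funext => x; rewrite big_cons.
exact: Ck_add.
Qed.

(** In the chain rule the direction ['d f x v] in which g is differentiated moves with x, which [Ck]
    does not allow. Expanding it in the basis leaves derivatives of g in fixed directions, to which
    the induction hypothesis applies. *)
Lemma Ck_comp U V n (f : U -> V) (g : V -> R) : fin_basis V ->
  Ck n f -> Ck n g -> Ck n (fun x => g (f x)).
Proof.
move=> [I [e [l [lc lE]]]]; elim: n g => [|n IH] g Cf Cg.
  by move=> x; apply: continuous_comp; [exact: Cf|exact: Cg].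
have Cf0 := CkW Cf; move: Cf Cg => [df Cf] [dg Cg].
apply: (@Ck_isdiff _ _ _ _ (fun x v => 'd g (f x) ('d f x v))) => [x|v].
  by apply: is_diff_comp; exact: differentiableP.
have -> : (fun x => 'd g (f x) ('d f x v)) =
    (fun x => \sum_i l i ('D_v f x) * 'D_(e i) g (f x)).
  apply/funext => x; rewrite -[X in 'd g _ X]deriveE //.
  transitivity ('d g (f x) (\sum_i l i ('D_v f x) *: e i));
    first by rewrite -lE.
  rewrite linear_sum.
  by apply: eq_bigr => i _; rewrite linearZ /= [ 'D_(e i) g _]deriveE.
apply: Ck_sum => i; apply: Ck_mul.
  by apply: (@Ck_linear_comp _ _ _ n (l i)); [exact: lc|exact: Cf].
exact: (IH ('D_(e i) g) Cf0 (Cg (e i))).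
Qed.

Lemma fin_basisR : fin_basis R.
Proof.
exists 'I_1, (fun=> 1), (fun=> idfun : {linear R -> R}); split => [i x|v].
  exact: cvg_id.
by rewrite big_ord1 /= [RHS]mulr1.
Qed.

Lemma fin_basis_prod V W : fin_basis V -> fin_basis W -> fin_basis (V * W)%type.
Proof.
move=> [I [e [l [lc lE]]]] [J [e' [l' [lc' lE']]]].
exists (I + J)%type, (fun i => match i with inl i => (e i, 0) | inr j =>
  (0, e' j) end).
pose L i : {linear (V * W)%type -> R} := match i with
  | inl i => l i \o (fst : V * W -> V) : {linear (V * W)%type -> R}
  | inr j => l' j \o (snd : V * W -> W) : {linear (V * W)%type -> R} end.
exists L; split => [[i|j] z|[v w]] /=.
- by apply: (@continuous_comp _ _ _ fst (l i)); [exact: cvg_fst|exact: lc].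
- by apply: (@continuous_comp _ _ _ snd (l' j)); [exact: cvg_snd|exact: lc'].
rewrite big_sumType /=; congr pair; rewrite /= ?raddf_sum /=.
  rewrite [X in _ + X]big1 ?addr0; last by move=> j _; rewrite scaler0.
  exact: lE.
rewrite [X in X + _]big1 ?add0r; last by move=> j _; rewrite scaler0.
exact: lE'.
Qed.

Lemma smooth_cst V W (a : W) : smooth (fun _ : V => a).
Proof. by move=> n; exact: Ck_cst. Qed.

Lemma smooth_lin V W (l : {linear V -> W}) : continuous l -> smooth l.
Proof. by move=> lc n; exact: Ck_lin. Qed.

Lemma smooth_id V : smooth (fun x : V => x).
Proof. by apply: (@smooth_lin V V idfun) => x; exact: cvg_id. Qed.

Lemma smooth_fst V W : smooth (fun z : V * W => z.1).
Proof. by apply: (@smooth_lin _ _ fst) => x; exact: cvg_fst. Qed.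

Lemma smooth_snd V W : smooth (fun z : V * W => z.2).
Proof. by apply: (@smooth_lin _ _ snd) => x; exact: cvg_snd. Qed.

Lemma smoothD V W (f g : V -> W) : smooth f -> smooth g ->
  smooth (fun x => f x + g x).
Proof. by move=> fs gs n; exact: Ck_add. Qed.

Lemma smoothM V (f g : V -> R) : smooth f -> smooth g ->
  smooth (fun x => f x * g x).
Proof. by move=> fs gs n; exact: Ck_mul. Qed.

Lemma smoothN V (f : V -> R) : smooth f -> smooth (fun x => - f x).
Proof.
move=> fs; have -> : (fun x => - f x) = (fun x => (-1) * f x).
  by apply/funext => x; rewrite mulN1r.
by apply: smoothM => //; exact: smooth_cst.
Qed.

Lemma smoothB V (f g : V -> R) : smooth f -> smooth g ->
  smooth (fun x => f x - g x).
Proof. by move=> fs gs; apply: smoothD => //; exact: smoothN. Qed.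

Lemma smoothV V (f : V -> R) : (forall x, f x != 0) -> smooth f ->
  smooth (fun x => (f x)^-1).
Proof. by move=> f0 fs n; exact: Ck_inv. Qed.

Lemma smooth_pair U V W (f : U -> V) (g : U -> W) : smooth f -> smooth g ->
  smooth (fun x => (f x, g x)).
Proof. by move=> fs gs n; exact: Ck_pair. Qed.

Lemma smooth1 U V W (f : U -> V * W) : smooth f -> smooth (fun x => (f x).1).
Proof.
move=> fs n; apply: (@Ck_linear_comp _ _ _ _ fst) => // x; exact: cvg_fst.
Qed.

Lemma smooth2 U V W (f : U -> V * W) : smooth f -> smooth (fun x => (f x).2).
Proof.
move=> fs n; apply: (@Ck_linear_comp _ _ _ _ snd) => // x; exact: cvg_snd.
Qed.

Lemma smooth_comp U V (f : U -> V) (g : V -> R) : fin_basis V ->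
  smooth f -> smooth g -> smooth (fun x => g (f x)).
Proof. by move=> bV fs gs n; exact: Ck_comp. Qed.

Lemma smooth_comp2 U V (f : U -> V) (g : V -> plane R) : fin_basis V ->
  smooth f -> smooth g -> smooth (fun x => g (f x)).
Proof.
move=> bV fs gs; have -> : (fun x => g (f x)) =
  (fun x => ((g (f x)).1, (g (f x)).2)).
  by apply/funext => x; rewrite -surjective_pairing.
apply: smooth_pair.
  by apply: (smooth_comp bV fs (g := fun y => (g y).1)); exact: smooth1.
by apply: (smooth_comp bV fs (g := fun y => (g y).2)); exact: smooth2.
Qed.

Lemma smooth_derive V W (f : V -> W) v : smooth f -> smooth (fun x => 'D_v f x).
Proof. by move=> fs n; have [_] := fs n.+1; exact. Qed.

Lemma smooth_diff V W (f : V -> W) x : smooth f -> differentiable f x.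
Proof. by move=> /(_ 1%N) []. Qed.

Lemma smooth_derivable V W (f : V -> W) x v : smooth f -> derivable f x v.
Proof. by move=> fs; apply: diff_derivable; exact: smooth_diff. Qed.

Lemma fin_basis_plane : fin_basis (plane R).
Proof. by apply: fin_basis_prod; exact: fin_basisR. Qed.

Lemma fin_basis_Rplane : fin_basis (R * plane R)%type.
Proof. by apply: fin_basis_prod; [exact: fin_basisR|exact: fin_basis_plane].
Qed.

Lemma Ck_real n (f f' : R -> R) : (forall x, is_derive x (1 : R) f (f' x)) ->
  Ck n f' -> Ck n.+1 f.
Proof.
move=> fd Cf'.
suff H x : is_diff x f (fun v => v * f' x).
  by apply: (Ck_isdiff H) => v; apply: Ck_mul => //; exact: Ck_cst.
have df : differentiable f x by apply/derivable1_diffP; case: (fd x).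
split=> //; apply/funext => v; rewrite -[v in LHS]mulr1 [LHS]linearZ /=
  -deriveE //.
by have -> : 'D_1 f x = f' x by case: (fd x).
Qed.

Lemma is_diff_eps V W (f : V -> W) (df : {linear V -> W}) x : continuous df ->
  (forall e : R, 0 < e ->
     \forall h \near (0 : V), `|f (x + h) - f x - df h| <= e * `|h|) ->
  is_diff x f df.
Proof.
move=> dfc H.
have E : f \o shift x = cst (f x) + df +o_ 0 id.
  apply/eqaddoP => e e0; have := H e e0; apply: filterS => h /=.
  by rewrite fctE /= opprD addrA [h + x]addrC.
have d : 'd f x = df :> (V -> W) by exact: diff_unique.
split => //; apply/diff_locallyP; rewrite d; split => //.
Qed.

Lemma diff_epsE V W (f : V -> W) x : differentiable f x -> forall e :
  R, 0 < e ->
  \forall h \near (0 : V), `|f (x + h) - f x - 'd f x h| <= e * `|h|.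
Proof.
move=> fd e e0; have /eqaddoP/(_ e e0) := diff_locally fd.
by apply: filterS => h; rewrite fctE /= opprD addrA [h + x]addrC.
Qed.

End SmoothCalculus.

Ltac smth := repeat first
  [ assumption
  | exact: smooth_id | exact: smooth_fst | exact: smooth_snd | exact: smooth_cst
  | apply: smoothB | apply: smoothD | apply: smoothN | apply: smoothM
  | apply: smooth_pair | apply: smooth1 | apply: smooth2
  | apply: smooth_derive ].

(** * Implicit functions *)

Section Implicit.
Context {R : realType}.

Lemma is_derive_line (V W : normedModType R) (f : V -> W) x v (t : R) :
  differentiable f (x + t *: v) ->
  is_derive t (1 : R) (fun s : R => f (x + s *: v)) ('D_v f (x + t *: v)).
Proof.
move=> df.
have d1 : is_diff t (fun s : R => x + s *: v) (fun s => s *: v).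
  have : is_diff t (cst x + ( *:%R^~ v : R -> V)) (0 + ( *:%R^~ v : R -> V)).
    by apply: is_diffD.
  by rewrite add0r.
have d2 : is_diff t (f \o (fun s : R => x + s *: v))
  ('d f (x + t *: v) \o ( *:%R^~ v)).
  by apply: is_diff_comp; exact: differentiableP.
have [d3 d4] := d2; split; first exact: diff_derivable.
by rewrite deriveE // d4 /= scale1r deriveE.
Qed.

Lemma derive_cst_near (V W : normedModType R) (f : V -> W) x v :
  (\forall y \near x, f y = f x) -> 'D_v f x = 0.
Proof. by move=> H; rewrite (near_eq_derive v H) derive_cst. Qed.

(** The second difference over the parallelogram with sides s u and s v is an increment of an
    increment: two mean value theorems, along u and then along v, produce the intermediate point. *)
Lemma schwarz_aux (V : normedModType R) (f : V -> R) x u v (s : R) :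
  smooth f -> 0 < s -> exists a b, [/\ 0 <= a <= s, 0 <= b <= s &
    f (x + s *: u + s *: v) - f (x + s *: u) - f (x + s *: v) + f x =
    s * s * 'D_v ('D_u f) (x + a *: u + b *: v)].
Proof.
move=> fs s0; have fdiff y : differentiable f y by exact: smooth_diff.
have fudiff y : differentiable ('D_u f) y by apply: smooth_diff;
  exact: smooth_derive.
pose g a := f (x + s *: v + a *: u) - f (x + a *: u).
have gd a : is_derive a (1 : R) g ('D_u f (x + s *: v + a *: u) - 'D_u f
  (x + a *: u)).
  by apply: is_deriveB; exact: is_derive_line.
have gc : {within `[0, s], continuous g}.
  by apply: derivable_within_continuous => a _; case: (gd a).
have [a /itvP ain ga] := MVT s0 (fun a _ => gd a) gc.
pose k b := 'D_u f (x + a *: u + b *: v).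
have kd b : is_derive b (1 : R) k ('D_v ('D_u f) (x + a *: u + b *: v)).
  exact: is_derive_line.
have kc : {within `[0, s], continuous k}.
  by apply: derivable_within_continuous => b _; case: (kd b).
have [b /itvP bin kb] := MVT s0 (fun b _ => kd b) kc.
exists a, b; split; rewrite ?ain ?bin //.
have -> : f (x + s *: u + s *: v) - f (x + s *: u) - f (x + s *: v) + f x =
  g s - g 0.
  by rewrite /g !scale0r !addr0 [x + s *: v + s *: u]addrAC; ring.
rewrite ga subr0 addrAC.
have -> : 'D_u f (x + a *: u + s *: v) - 'D_u f (x + a *: u) = k s - k 0.
  by rewrite /k scale0r addr0.
by rewrite kb subr0; ring.
Qed.

(** The second difference is symmetric in u and v, so the two mixed derivatives agree at two points
    that can be taken arbitrarily close to x; continuity costs e / 2 for each. *)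
Lemma schwarz (V : normedModType R) (f : V -> R) x u v : smooth f ->
  'D_v ('D_u f) x = 'D_u ('D_v f) x.
Proof.
move=> fs; apply/eqP; rewrite -subr_eq0 -normr_le0; apply/ler_addgt0Pl => e e0.
rewrite addr0.
have H (w z : V) : exists2 r, 0 < r & forall a b, 0 <= a < r -> 0 <= b < r ->
    `|'D_w ('D_z f) x - 'D_w ('D_z f) (x + a *: z + b *: w)| < e / 2.
  pose phi (q : R * R) : R := 'D_w ('D_z f) (x + q.1 *: z + q.2 *: w).
  have phic : {for (0, 0), continuous phi}.
    apply: (@continuous_comp _ _ _ (fun q : R * R => x + q.1 *: z + q.2 *: w)
      ('D_w ('D_z f))).
      apply: cvgD; first apply: cvgD; first exact: cvg_cst.
        by apply: cvgZr_tmp; exact: cvg_fst.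
      by apply: cvgZr_tmp; exact: cvg_snd.
    by apply: smooth_continuous; do 2!apply: smooth_derive.
  have e2 : 0 < e / 2 by rewrite divr_gt0.
  have /nbhs_ballP[r /= r0 hr] : \forall q \near (0 : R, 0 : R), `|phi (0, 0) -
    phi q| < e / 2.
    by move/cvgrPdist_lt : phic => /(_ _ e2).
  exists r => // a b /andP[a0 ar] /andP[b0 br].
  have := hr (a, b); rewrite /phi /= !scale0r !addr0; apply.
  by split; rewrite /ball /= sub0r normrN ger0_norm.
have [r1 r10 H1] := H v u; have [r2 r20 H2] := H u v.
pose d := Num.min r1 r2 / 2.
have d0 : 0 < d by rewrite divr_gt0 // lt_min r10.
have dr1 : d < r1.
  have : Num.min r1 r2 <= r1 by rewrite ge_min lexx.
  by rewrite /d; lra.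
have dr2 : d < r2.
  have : Num.min r1 r2 <= r2 by rewrite ge_min lexx orbT.
  by rewrite /d; lra.
have [a [b [/andP[a0 ad] /andP[b0 bd] E1]]] := schwarz_aux x u v fs d0.
have [a' [b' [/andP[a'0 ad'] /andP[b'0 bd'] E2]]] := schwarz_aux x v u fs d0.
have E : 'D_v ('D_u f) (x + a *: u + b *: v) = 'D_u ('D_v f) (x + a' *:
  v + b' *: u).
  apply: (@mulfI _ (d * d)); first by rewrite mulf_neq0 // gt_eqF.
  apply: (etrans (esym E1)); apply: (etrans _ E2).
  by rewrite [x + d *: u + _]addrAC; congr (_ + _); exact: addrAC.
have h1 : `|'D_v ('D_u f) x - 'D_v ('D_u f) (x + a *: u + b *: v)| < e / 2.
  by apply: H1; rewrite ?a0 ?b0 /= (le_lt_trans _ dr1).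
have h2 : `|'D_u ('D_v f) x - 'D_u ('D_v f) (x + a' *: v + b' *: u)| < e / 2.
  by apply: H2; rewrite ?a'0 ?b'0 /= (le_lt_trans _ dr2).
rewrite E in h1; rewrite distrC in h2.
rewrite [e]splitr; apply: ltW.
exact: le_lt_trans (ler_distD _ _ _) (ltrD h1 h2).
Qed.

Section ImplicitFunction.
Context {P : normedModType R} (F : P * R -> R).
Context (bP : fin_basis P) (Fs : smooth F)
  (F'ge : forall z, 1 / 2 <= 'D_(0, 1) F z).

Let Fline p (z : R) :
  is_derive z (1 : R) (fun z => F (p, z)) ('D_(0, 1) F (p, z)).
Proof.
have E (s : R) : (p, s) = (p, 0) + s *: ((0, 1) : P * R).
  by congr pair; rewrite /= ?scaler0 ?addr0 // add0r [RHS]mulr1.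
have -> : (fun z => F (p, z)) = (fun z => F ((p, 0) + z *: ((0, 1) : P * R))).
  by apply/funext => s; rewrite -E.
by rewrite E; apply: is_derive_line; exact: smooth_diff.
Qed.

Let Fmono p (a b : R) : a <= b -> (b - a) / 2 <= F (p, b) - F (p, a).
Proof.
move=> ab.
have Fc : {within `[a, b], continuous (fun z => F (p, z))}.
  by apply: derivable_within_continuous => z _; case: (Fline p z).
have [c _ ->] := MVT_segment ab (fun z _ => Fline p z) Fc.
have := F'ge (p, c); move: ab; rewrite -subr_ge0; nra.
Qed.

(** As F(p, .) stretches distances by a factor at least 1/2, this one estimate gives injectivity,
    the continuity of the solution G and the linear bound on its increments. *)
Let Fdist p (a b : R) : `|a - b| <= 2 * `|F (p, a) - F (p, b)|.
Proof.
wlog ab : a b / a <= b.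
  move=> H; have [/H//|/ltW/H] := leP a b.
  by rewrite distrC [`|F _ - _|]distrC.
rewrite distrC [`|F _ - _|]distrC.
have := Fmono p ab; have : 0 <= b - a by rewrite subr_ge0.
move=> h1 h2; rewrite !ger0_norm //; lra.
Qed.

Let Fsurj p y : exists z, F (p, z) = y.
Proof.
(* With slope at least 1/2, F(p, .) covers the distance from F(p, 0) to y within M on either side of
   0. *)
pose M := 2 * `|y - F (p, 0)|.
have M0 : 0 <= M by rewrite mulr_ge0.
have h1 : y <= F (p, M).
  have := Fmono p M0; have := ler_norm (y - F (p, 0)); rewrite /M; lra.
have h2 : F (p, - M) <= y.
  have h : - M <= 0 by lra.
  have := Fmono p h; have := ler_norm (- (y - F (p, 0))); rewrite normrN /M;
    lra.
have MM : - M <= M by lra.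
have [||c _ <-] := @IVT _ (fun z => F (p, z)) _ _ y MM; last by exists c.
  by apply: derivable_within_continuous => z _; case: (Fline p z).
by rewrite ge_min h2 /= le_max h1 orbT.
Qed.

Lemma implicit_function : exists G : P * R -> R,
  [/\ smooth G, forall p y, F (p, G (p, y)) = y &
      forall p z, G (p, F (p, z)) = z].
Proof.
have [G GE] : {G : P * R -> R & forall p y, F (p, G (p, y)) = y}.
  pose G (q : P * R) := projT1 (cid (Fsurj q.1 q.2)).
  by exists G => p y; rewrite /G; case: cid.
have GK p z : G (p, F (p, z)) = z.
  apply/eqP; rewrite -subr_eq0 -normr_le0; apply: le_trans (Fdist p _ _) _.
  by rewrite GE subrr normr0 mulr0.
exists G; split => //.
have GE' w : F (w.1, G w) = w.2 by case: w => p y; exact: GE.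
have Gdist w w0 : `|G w - G w0| <= 2 * `|w.2 - F (w.1, G w0)|.
  by apply: le_trans (Fdist w.1 _ _) _; rewrite GE'.
have Gc : continuous G.
  move=> w0; apply/cvgrPdist_lt => e e0.
  pose k (w : P * R) := w.2 - F (w.1, G w0).
  have kc : {for w0, continuous k}.
    apply: cvgB; first exact: cvg_snd.
    apply: (@continuous_comp _ _ _ (fun w : P * R => (w.1, G w0)) F).
      by apply: smooth_continuous; smth.
    exact: smooth_continuous.
  have e2 : 0 < e / 2 by rewrite divr_gt0.
  move/cvgrPdist_lt : kc => /(_ _ e2); apply: filterS => w.
  rewrite {1}/k GE' subrr sub0r normrN => kw.
  by rewrite distrC; apply: le_lt_trans (Gdist _ _) _; rewrite -/(k w); lra.
pose H w := (w.1, G w).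
have D0 w : 'D_(0, 1) F (H w) != 0
  by rewrite gt_eqF // (lt_le_trans _ (F'ge _)).
(* Obtained by differentiating F(p, G(p, y)) = y in the direction v and solving for the derivative
   of G. *)
pose dG w (v : P * R) := (v.2 - 'd F (H w) (v.1, 0)) * ('D_(0, 1) F (H w))^-1.
have Gd w : is_diff w G (dG w).
  have dGlin : linear (dG w).
    move=> a u v; rewrite /dG /=.
    have -> : (a *: u.1 + v.1, 0) = a *: ((u.1, 0) : P * R) + (v.1, 0).
      by congr pair => /=; rewrite scaler0 addr0.
    by rewrite linearP /GRing.scale /=; ring.
  pose dGM := GRing.isLinear.Build _ _ _ _ _ dGlin.
  pose dGL : {linear (P * R)%type -> R} := HB.pack (dG w) dGM.
  have Fd : differentiable F (H w) by exact: smooth_diff.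
  have dGc : continuous dGL.
    have c : continuous (fun v : P * R => v.2 - 'd F (H w) (v.1, 0));
      last first.
      by move=> v; exact: (cvgM (c v) (cvg_cst _)).
    move=> v; apply: cvgB; first exact: cvg_snd.
    apply: (@continuous_comp _ _ _ (fun v : P * R => (v.1, 0 : R))
      ('d F (H w))).
      by apply: smooth_continuous; smth.
    exact: diff_continuous.
  apply: (@is_diff_eps _ _ _ _ dGL) => // e e0.
  have [A A0 dFA] := linear_lipschitz (diff_continuous Fd).
  (* L bounds the increment of G by L |v|: a factor 2 from [Gdist], A from the differential of F,
     one unit from v.2 and one from the remainder at (v.1, 0). The 2 in e' compensates the division
     by a partial derivative that may be as small as 1/2. *)
  pose L := 2 * (2 + A); pose e' := e / (2 * L).
  have L1 : 1 <= L by rewrite /L; lra.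
  have e'0 : 0 < e' by rewrite divr_gt0 // mulr_gt0 // (lt_le_trans _ L1).
  have c1 : (fun v : P * R => (v.1, G (w + v) - G w)) @ (0 : P * R) -->
    (0 : P * R).
    have c : continuous (fun v : P * R => (v.1, G (w + v) - G w)).
      apply: (@Ck_pair _ _ _ _ 0); first by move=> v; exact: cvg_fst.
      move=> v; apply: cvgB; last exact: cvg_cst.
      apply: (@continuous_comp _ _ _ (fun v => w + v) G); last exact: Gc.
      by apply: cvgD; [exact: cvg_cst|exact: cvg_id].
    by have := c 0; rewrite /continuous_at /= addr0 subrr.
  have c2 : (fun v : P * R => (v.1, 0 : R)) @ (0 : P * R) --> (0 : P * R).
    have c : {for 0, continuous (fun v : P * R => (v.1, 0 : R))}.
      by apply: smooth_continuous; smth.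
    by move: c; rewrite /continuous_at.
  have n1 : \forall v \near (0 : P * R), `|F (H w + (v.1, G (w + v) - G w)) - F
    (H w) -
      'd F (H w) (v.1, G (w + v) - G w)| <= e' * `|(v.1, G (w + v) - G w) :
        P * R|.
    exact: c1 _ (diff_epsE Fd e'0).
  have n2 : \forall v \near (0 : P * R), `|F (H w + (v.1, 0)) - F (H w) -
      'd F (H w) (v.1, 0)| <= 1 * `|(v.1, 0) : P * R|.
    exact: c2 _ (diff_epsE Fd ltr01).
  near=> v; set z := G (w + v) - G w.
  have r1 : `|F (H w + (v.1, z)) - F (H w) - 'd F (H w) (v.1, z)| <=
    e' * `|(v.1, z) : P * R|.
    by rewrite /z; near: v; exact: n1.
  have r2 : `|F (H w + (v.1, 0)) - F (H w) - 'd F (H w) (v.1, 0)| <=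
    `|(v.1, 0) : P * R|.
    by rewrite -[leRHS]mul1r; near: v; exact: n2.
  have v1 : `|v.1| <= `|v| by rewrite prod_normE le_max lexx.
  have v2 : `|v.2| <= `|v| by rewrite prod_normE le_max lexx orbT.
  have v10 : `|(v.1, 0 : R) : P * R| <= `|v|.
    by rewrite prod_normE /= normr0 ge_max v1 normr_ge0.
  have zL : `|z| <= L * `|v|.
    apply: le_trans (Gdist _ _) _; rewrite /L -mulrA ler_pM2l //.
    have -> : (w + v).2 - F ((w + v).1, G w) = v.2 - 'd F (H w) (v.1, 0) -
       (F (H w + (v.1, 0)) - F (H w) - 'd F (H w) (v.1, 0)).
      rewrite -[F (H w)]/(F (w.1, G w)) GE'.
      have -> : H w + (v.1, 0) = ((w + v).1, G w) by congr pair;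
        rewrite /= ?addr0.
      rewrite /=; ring.
    apply: le_trans (ler_normB _ _) _; apply: le_trans (lerD (ler_normB _ _) r2)
      _.
    have := dFA (v.1, 0); nra.
  have -> : G (w + v) - G w - dGL v = - (F (H w + (v.1, z)) - F (H w) - 'd F
    (H w) (v.1, z)) * ('D_(0, 1) F (H w))^-1.
    rewrite /dGL /= /dG -[G (w + v) - G w]/z.
    have -> : H w + (v.1, z) = H (w + v) by congr pair; rewrite /= /z subrKC.
    rewrite -[F (H w)]/(F (w.1, G w))
      -[F (H (w + v))]/(F ((w + v).1, G (w + v))) !GE'.
    have -> : (v.1, z) = (v.1, 0) + z *: (0, 1) :> P * R.
      by congr pair; rewrite /= ?scaler0 ?addr0 // add0r [RHS]mulr1.
    have -> : 'd F (H w) ((v.1, 0) + z *: (0, 1)) = 'd F (H w) (v.1, 0) +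
      z * 'D_(0, 1) F (H w).
      by rewrite [LHS]linearD [X in _ + X = _]linearZ /= deriveE.
    rewrite [(w + v).2]/=.
    by field; exact: D0.
  rewrite normrM normrN normfV [X in _ / X]gtr0_norm; last first.
    by rewrite (lt_le_trans _ (F'ge _)).
  rewrite ler_pdivrMr; last by rewrite (lt_le_trans _ (F'ge _)).
  apply: le_trans r1 _.
  have hz : `|(v.1, z) : P * R| <= L * `|v|.
    by rewrite prod_normE /= ge_max zL andbT (le_trans v1) // ler_peMl.
  have : e' * `|(v.1, z) : P * R| <= e' * (L * `|v|) by rewrite ler_pM2l.
  move/le_trans; apply.
  have -> : e' * (L * `|v|) = e * `|v| * (1 / 2).
    by rewrite /e'; field; rewrite gt_eqF // (lt_le_trans _ L1).
  by rewrite ler_wpM2l // mulr_ge0 // ltW.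
(* The derivative of G is an expression in derivatives of F along H = (p, G), so regularity of order
   n for G yields order n + 1. *)
elim=> // n IH; apply: (Ck_isdiff Gd) => v.
have CH : Ck n H.
  by apply: Ck_pair => //; apply: smooth_fst.
have bPR : fin_basis (P * R)%type by apply: fin_basis_prod => //;
  exact: fin_basisR.
apply: Ck_mul; last first.
  apply: Ck_inv => //.
  by apply: (Ck_comp bPR CH (g := 'D_(0, 1) F)); apply: smooth_derive.
have -> : (fun w => v.2 - 'd F (H w) (v.1, 0)) =
  (fun w => v.2 + (-1) * 'D_(v.1, 0) F (H w)).
  by apply/funext => w; rewrite deriveE ?mulN1r //; exact: smooth_diff.
apply: Ck_add; first exact: Ck_cst.
apply: Ck_mul; first exact: Ck_cst.
by apply: (Ck_comp bPR CH (g := 'D_(v.1, 0) F)); apply: smooth_derive.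
Unshelve. all: by end_near. Qed.
End ImplicitFunction.
End Implicit.

(** * Bump functions *)

Section FlatFunctions.
Context {R : realType}.

(** The functions x^(-m) e^(-1/x) extended by 0: differentiation preserves their span, so all of
    them are proved smooth by one induction. *)
Definition flat (m : nat) (x : R) : R :=
  if 0 < x then x^-1 ^+ m * expR (- x^-1) else 0.

(** With y = 1/x, the exponential series gives y^(m+1) / (m+1)! <= e^y. This bound is linear in x;
    combined with [flatS] it becomes quadratic, which yields derivative 0 at the origin. *)
Lemma flat_le m x : `|flat m x| <= m.+1`!%:R * `|x|.
Proof.
rewrite /flat; case: ltP => [x0|_]; last by rewrite normr0 mulr_ge0.
have y0 : 0 < x^-1 by rewrite invr_gt0.
rewrite !ger0_norm ?(ltW x0) //; last by rewrite mulr_ge0 ?expR_ge0 ?exprn_ge0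
  // ltW.
rewrite expRN ler_pdivrMr ?expR_gt0 //.
have K0 : 0 < m.+1`!%:R :> R by rewrite ltr0n fact_gt0.
have h : x^-1 ^+ m.+1 <= expR x^-1 * m.+1`!%:R.
  rewrite -ler_pdivrMr //; apply: le_trans (expR_ge1Dxn m (ltW y0)).
  by rewrite lerDr.
have : x * x^-1 ^+ m.+1 <= x * (expR x^-1 * m.+1`!%:R) by rewrite ler_pM2l.
by rewrite exprS mulVKf ?gt_eqF // [_ * x]mulrC -mulrA [expR _ * _]mulrC.
Qed.

Lemma flatS m x : flat m x = x * flat m.+1 x.
Proof.
rewrite /flat; case: ltP => [x0|_]; last by rewrite mulr0.
by rewrite exprS !mulrA mulfV ?mul1r // gt_eqF.
Qed.

Lemma is_derive_flat m (x : R) :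
  is_derive x (1 : R) (flat m) (- m%:R * flat m.+1 x + flat m.+2 x).
Proof.
case: (ltgtP x 0) => [x0|x0|->].
- have -> : - m%:R * flat m.+1 x + flat m.+2 x = 0.
    by rewrite /flat ltNge (ltW x0) /= mulr0 addr0.
  apply: (near_eq_is_derive (f := cst 0)) => //.
  by near=> y; rewrite /flat ltNge ltW //=; near: y; exact: lt_nbhsl.
- pose f (x : R) := x^-1 ^+ m * expR (- x^-1).
  suff fd : is_derive x (1 : R) f (- m%:R * flat m.+1 x + flat m.+2 x).
    apply: (near_eq_is_derive (f := f)) => //.
    by near=> y; rewrite /flat ifT //; near: y; exact: lt_nbhsr.
  have xn0 : x != 0 by rewrite gt_eqF.
  have d1 : is_derive x (1 : R) (fun y : R => y^-1) (- (x^-1 * x^-1)).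
    have := @is_deriveV _ id x 1 1 xn0 (is_derive_id _ _).
    by rewrite /GRing.scale /= mulr1 expr2 invfM.
  have d2 : is_derive x (1 : R) (fun y : R => - y^-1) (x^-1 * x^-1).
    by have := is_deriveN d1; rewrite opprK.
  have d3 := @is_derive1_comp _ expR (fun y => - y^-1) x _ _ (is_derive_expR _)
    d2.
  have d4 : is_derive x (1 : R) (fun y : R => y^-1 ^+ m) (m%:R * x^-1 ^+
    m.-1 * - (x^-1 * x^-1)).
    by have := is_deriveX m d1; rewrite exprfctE.
  have d5 : is_derive x (1 : R) f _ := is_deriveM d4 d3.
  apply: (is_derive_eq d5).
  rewrite /flat x0 /GRing.scale /=; case: (m) => [|n] /=;
    first by rewrite expr0 expr1; ring.
  by rewrite !exprS; ring.
- have -> : - m%:R * flat m.+1 0 + flat m.+2 0 = 0.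
    by rewrite /flat ltxx mulr0 addr0.
  have [d e] : is_diff (0 : R) (flat m) (\0 : {linear R -> R}).
    apply: is_diff_eps => [z|e e0]; first exact: cvg_cst.
    have K0 : 0 < m.+2`!%:R :> R by rewrite ltr0n fact_gt0.
    have eK : 0 < e / m.+2`!%:R by rewrite divr_gt0.
    apply: filterS (nbhs0_le eK) => h hK; rewrite add0r {2}/flat ltxx !subr0
      flatS normrM mulrC.
    rewrite ler_wpM2r //; apply: le_trans (flat_le _ _) _.
    rewrite mulrC -ler_pdivlMr //.
  by split; [exact: diff_derivable|rewrite deriveE // e].
Unshelve. all: by end_near. Qed.

Lemma smooth_flat m : smooth (flat m).
Proof.
move=> n; elim: n m => [|n IH] m.
  by move=> x; apply/differentiable_continuous/derivable1_diffP;
    case: (is_derive_flat m x).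
apply: (Ck_real (is_derive_flat m)); apply: Ck_add => //.
by apply: Ck_mul => //; exact: Ck_cst.
Qed.

Lemma flat_gt0 m x : 0 < x -> 0 < flat m x.
Proof. by move=> x0; rewrite /flat x0 mulr_gt0 ?expR_gt0 // exprn_gt0 //
  invr_gt0. Qed.

Lemma flat_ge0 m x : 0 <= flat m x.
Proof. by have [/(flat_gt0 m)/ltW//|x0] := ltP 0 x; rewrite /flat ltNge x0. Qed.

Definition step (x : R) := flat 0 x / (flat 0 x + flat 0 (1 - x)).

Lemma step_den_gt0 x : 0 < flat 0 x + flat 0 (1 - x).
Proof.
have [x0|x0] := ltP 0 x; first by rewrite ltr_pwDl ?flat_gt0 ?flat_ge0.
by rewrite ltr_pwDr ?flat_ge0 ?flat_gt0 //; lra.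
Qed.

Lemma smooth_step : smooth step.
Proof.
apply: smoothM; first exact: smooth_flat.
apply: smoothV; first by move=> x; rewrite gt_eqF // step_den_gt0.
apply: smoothD; first exact: smooth_flat.
apply: (smooth_comp fin_basisR (g := flat 0)); last exact: smooth_flat.
by smth.
Qed.

Lemma step0 x : x <= 0 -> step x = 0.
Proof. by move=> x0; rewrite /step {1}/flat ltNge x0 mul0r. Qed.

Lemma step1 x : 1 <= x -> step x = 1.
Proof.
move=> x1; have E : flat 0 (1 - x) = 0 by rewrite /flat ltNge subr_le0 x1.
by rewrite /step E addr0 divff // gt_eqF // flat_gt0 // (lt_le_trans ltr01).
Qed.

Lemma step_ge0 x : 0 <= step x.
Proof. by rewrite divr_ge0 ?flat_ge0 // ltW // step_den_gt0. Qed.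

Lemma step_le1 x : step x <= 1.
Proof. by rewrite ler_pdivrMr ?step_den_gt0 // mul1r lerDl flat_ge0. Qed.

Definition bump (x : R) := step (2 - x) * step (2 + x).

Lemma smooth_bump : smooth bump.
Proof.
by apply: smoothM; apply: (smooth_comp fin_basisR (g := step));
  try exact: smooth_step; smth.
Qed.

Lemma bump_ge0 x : 0 <= bump x.
Proof. by rewrite mulr_ge0 ?step_ge0. Qed.

Lemma bump1 x : `|x| <= 1 -> bump x = 1.
Proof. by rewrite ler_norml => /andP[h1 h2]; rewrite /bump !step1 ?mulr1 //;
  lra. Qed.

Lemma bump0 x : 2 <= `|x| -> bump x = 0.
Proof.
rewrite ler_normr => /orP[h|h]; rewrite /bump; first by rewrite step0 ?mul0r //;
  lra.
by rewrite [step (2 + x)]step0 ?mulr0 //; lra.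
Qed.

(** * Square cutoffs and compactly supported functions on the plane *)

Definition box (p : plane R) (r : R) : set (plane R) :=
  `[p.1 - r, p.1 + r] `*` `[p.2 - r, p.2 + r].

Lemma compact_box p r : compact (box p r).
Proof. by apply: compact_setX; exact: segment_compact. Qed.

Lemma boxP p r q : box p r q <-> `|q - p| <= r.
Proof.
rewrite prod_normE ge_max /box /= !in_itv /= !ler_norml.
split=> [[/andP[a b] /andP[c d]]|/andP[/andP[a b] /andP[c d]]].
  by rewrite !lerBlDr !lerBrDr; apply/andP; split; apply/andP; split; lra.
by split; apply/andP; split; move: a b c d => /=; lra.
Qed.

(** The plane carries the max norm, so its closed balls are boxes and a product of one-variable
    bumps is a cutoff between concentric balls of radii r and 2 r. *)
Definition bump2 (p : plane R) (r : R) (q : plane R) :=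
  bump ((q.1 - p.1) / r) * bump ((q.2 - p.2) / r).

Lemma smooth_bump2 p r : smooth (bump2 p r).
Proof.
by apply: smoothM; apply: (smooth_comp fin_basisR (g := bump));
  try exact: smooth_bump; smth.
Qed.

Lemma bump2_ge0 p r q : 0 <= bump2 p r q.
Proof. by rewrite mulr_ge0 ?bump_ge0. Qed.

Lemma bump2_1 p r q : 0 < r -> `|q - p| <= r -> bump2 p r q = 1.
Proof.
move=> r0; rewrite prod_normE ge_max => /andP[h1 h2].
by rewrite /bump2 !bump1 ?mulr1 // normrM normfV (gtr0_norm r0) ler_pdivrMr //
  mul1r.
Qed.

Lemma bump2_0 p r q : 0 < r -> bump2 p r q != 0 -> box p (2 * r) q.
Proof.
move=> r0; rewrite mulf_eq0 negb_or => /andP[h1 h2]; apply/boxP.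
rewrite prod_normE ge_max /=; apply/andP; split; rewrite leNgt; apply/negP => h.
  by move/eqP: h1; apply; apply: bump0; rewrite normrM normfV (gtr0_norm r0)
    ler_pdivlMr // ltW.
by move/eqP: h2; apply; apply: bump0; rewrite normrM normfV (gtr0_norm r0)
  ler_pdivlMr // ltW.
Qed.

Lemma box_sub_nbhs p (B : set (plane R)) : nbhs p B ->
  exists2 r, 0 < r & box p r `<=` B.
Proof.
move=> /nbhs_ballP[e /= e0 eB]; exists (e / 2); first by rewrite divr_gt0.
move=> q /boxP qp; apply: eB; rewrite -ball_normE /= distrC (le_lt_trans qp) //;
  lra.
Qed.

Lemma test_functionS (h : plane R -> R) (K : set (plane R)) : smooth h ->
  compact K -> (forall p, h p != 0 -> K p) -> test_function h.
Proof.
move=> hs Kc hK; split => //; apply: (subclosed_compact _ Kc); first exact: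
  closed_closure.
have Kcl : closed K by apply: compact_closed => //; exact: norm_hausdorff.
by rewrite [X in _ `<=` X](closure_id K).1 //; apply: closure_subset.
Qed.

Lemma derive_neq0_closure (h : plane R -> R) v p : 'D_v h p != 0 ->
  closure [set q | h q != 0] p.
Proof.
apply: contra_neqP => hp.
have np : nbhs p (~` closure [set q | h q != 0]).
  by apply: open_nbhs_nbhs; split => //; exact/closed_openC/closed_closure.
have h0 : \forall q \near p, h q = 0.
  apply: filterS np => q; apply: contra_notP => /eqP hq.
  exact: subset_closure.
apply: derive_cst_near; rewrite (nbhs_singleton h0); exact: h0.
Qed.

Lemma derive_neq0_compact (h : plane R -> R) (K : set (plane R)) v p :
  compact K -> (forall q, h q != 0 -> K q) -> 'D_v h p != 0 -> K p.
Proof.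
move=> Kc hK /derive_neq0_closure.
have Kcl : closed K by apply: compact_closed => //; exact: norm_hausdorff.
by rewrite [K](closure_id K).1 //; exact: closure_subset.
Qed.

Lemma compact_box_cover (K : set (plane R)) : compact K ->
  exists2 M, 0 < M & K `<=` box 0 M.
Proof.
move=> /compact_bounded[M [_ KM]]; exists (`|M| + 1); first by rewrite ltr_pwDr.
move=> p Kp; apply/boxP; rewrite subr0; apply: KM => //.
by rewrite (le_lt_trans (ler_norm M)) // ltrDl.
Qed.

Lemma test_function_box (h : plane R -> R) : test_function h ->
  exists2 M, 0 < M & forall p, M < `|p| -> h p = 0.
Proof.
move=> [_ /compact_box_cover[M M0 hM]]; exists M => // p.
apply: contraTeq => hp; rewrite -leNgt -[p]subr0; apply/boxP/hM.
exact: subset_closure.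
Qed.

Lemma test_function_bounded (h : plane R -> R) : test_function h ->
  exists2 M, 0 < M & forall p, `|h p| <= M.
Proof.
move=> [hs Kc]; have /compact_bounded[M [_ KM]] :
  compact (h @` closure [set q | h q != 0]).
  apply: continuous_compact => //; apply: continuous_subspaceT.
  exact: smooth_continuous.
exists (`|M| + 1); first by rewrite ltr_pwDr.
move=> p; have [->|hp] := eqVneq (h p) 0; first by rewrite normr0 addr_ge0.
apply: KM; first by rewrite (le_lt_trans (ler_norm M)) // ltrDl.
by exists p => //; exact: subset_closure.
Qed.

Lemma test_function_derive (h : plane R -> R) v : test_function h ->
  test_function ('D_v h).
Proof.
move=> [hs Kc]; apply: (@test_functionS _ _ _ Kc); first exact: smooth_derive.
by move=> p; exact: derive_neq0_closure.
Qed.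
End FlatFunctions.

(** * Hamiltonian isotopies from generating functions *)

Section PlaneDerivatives.
Context {R : realType}.
Implicit Types (V W : normedModType R) (f : plane R -> R).

Lemma diff_plane f p v : differentiable f p ->
  'd f p v = v.1 * 'D_ex f p + v.2 * 'D_ey f p.
Proof. by move=> df; rewrite -omega_ham_vf // /omega /ham_vf /=; ring. Qed.

Lemma derive_chain V f (u v : V -> R) z w : smooth f ->
  differentiable u z -> differentiable v z ->
  'D_w (fun z => f (u z, v z)) z =
  'D_w u z * 'D_ex f (u z, v z) + 'D_w v z * 'D_ey f (u z, v z).
Proof.
move=> fs du dv; have df : differentiable f (u z, v z) by exact: smooth_diff.
have duv : differentiable (fun z => (u z, v z)) z by exact: differentiable_pair.
have -> : (fun z => f (u z, v z)) = f \o (fun z => (u z, v z)) by [].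
rewrite deriveE; last exact: differentiable_comp.
by rewrite diff_comp //= diff_pair // diff_plane //= !deriveE.
Qed.

(** Only the values of f on one line enter, so derivatives of coordinates, of functions constant in
    a direction and of vanishing restrictions are read off by evaluation. *)
Lemma derive_affine V W (f : V -> W) z w c :
  (forall s : R, f (z + s *: w) = f z + s *: c) -> 'D_w f z = c.
Proof.
move=> fE; rewrite /derive; apply: lim_near_cst => //.
near=> h; have h0 : h != 0 by near: h; exact: nbhs_dnbhs_neq.
by rewrite /= [_ + z]addrC fE addrAC subrr add0r scalerA mulVf // scale1r.
Unshelve. all: by end_near. Qed.

(** The shape u + c f(a, b) is common to the generating equations: a coordinate, plus the factor k
    times a partial derivative of S. *)
Lemma derive_shear V f (u c a b : V -> R) z w : smooth f ->
  smooth u -> smooth c -> smooth a -> smooth b ->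
  'D_w (fun z => u z + c z * f (a z, b z)) z = 'D_w u z +
    ('D_w c z * f (a z, b z) +
    c z * ('D_w a z * 'D_ex f (a z, b z) + 'D_w b z * 'D_ey f (a z, b z))).
Proof.
move=> fs us cs sa sb.
have gs : smooth (fun z => f (a z, b z)).
  by apply: (smooth_comp fin_basis_plane _ fs); smth.
have du : derivable u z w by exact: smooth_derivable.
have dc : derivable c z w by exact: smooth_derivable.
have dg : derivable (fun z => f (a z, b z)) z w by exact: smooth_derivable.
rewrite -derive_chain //; try exact: smooth_diff.
have -> : (fun z => u z + c z * f (a z, b z)) = u +
  (c * (fun z => f (a z, b z))) by [].
have E := deriveD du (derivableM dc dg); rewrite (deriveM dc dg) in E.
apply: (etrans E); congr (_ + _); rewrite [RHS]addrC; congr (_ + _);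
  exact: mulrC.
Qed.

Lemma derive_fst (p w : plane R) : 'D_w (fun r : plane R => r.1) p = w.1.
Proof. exact: derive_affine. Qed.

Lemma derive_snd (p w : plane R) : 'D_w (fun r : plane R => r.2) p = w.2.
Proof. exact: derive_affine. Qed.

Lemma derive_graph f (X : plane R -> R) (c : R) q w : smooth f -> smooth X ->
  'D_w (fun r => c * f (X r, r.2)) q =
  c * ('D_w X q * 'D_ex f (X q, q.2) + w.2 * 'D_ey f (X q, q.2)).
Proof.
move=> fs Xs.
have -> : (fun r => c * f (X r, r.2)) = (fun r => 0 + c * f (X r, r.2)).
  by apply/funext => r; rewrite add0r.
rewrite (@derive_shear _ f (fun=> 0) (fun=> c) X (fun r => r.2) q w fs
  (@smooth_cst _ _ _ 0) (@smooth_cst _ _ _ c) Xs (@smooth_snd _ _ _)).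
by rewrite (derive_cst (0 : R)) (derive_cst (c : R)) mul0r !add0r derive_snd.
Qed.

(** To be used with f = S_Y and with X the initial abscissa as a function of the final point r. *)
Lemma derive_implicit_space f (X : plane R -> R) (c : R) q w :
  smooth f -> smooth X -> (forall r, r.1 = X r + c * f (X r, r.2)) ->
  w.1 = 'D_w X q +
    c * ('D_w X q * 'D_ex f (X q, q.2) + w.2 * 'D_ey f (X q, q.2)).
Proof.
move=> fs Xs E; rewrite -[LHS](derive_fst q).
have -> : (fun r : plane R => r.1) = (fun r => X r + c * f (X r, r.2)).
  by apply/funext => r; exact: E.
rewrite (@derive_shear _ f X (fun=> c) X (fun r => r.2) q w fs Xs
  (@smooth_cst _ _ _ c) Xs (@smooth_snd _ _ _)).
by rewrite (derive_cst (c : R)) mul0r add0r derive_snd.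
Qed.

Lemma derive_time f (k U : R -> R) (x c t : R) :
  smooth f -> smooth k -> smooth U ->
  'D_1 (fun s => c + k s * f (x, U s)) t =
  'D_1 k t * f (x, U t) + k t * ('D_1 U t * 'D_ey f (x, U t)).
Proof.
move=> fs ks Us.
rewrite (@derive_shear _ f (fun=> c) k (fun=> x) U t 1 fs (@smooth_cst _ _ _ c)
  ks
  (@smooth_cst _ _ _ x) Us).
by rewrite (derive_cst (c : R)) (derive_cst (x : R)) mul0r !add0r.
Qed.

(** To be used with f = S_x and with U the final ordinate, as a function of time, of the fixed
    initial point (x, y). *)
Lemma derive_implicit_time f (k U : R -> R) (x y t : R) :
  smooth f -> smooth k -> smooth U -> (forall s, y = U s + k s * f (x, U s)) ->
  0 = 'D_1 U t + ('D_1 k t * f (x, U t) + k t * ('D_1 U t * 'D_ey f (x, U t))).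
Proof.
move=> fs ks Us E; rewrite -[LHS](derive_cst (y : R) (t : R) 1).
have -> : cst y = (fun s => U s + k s * f (x, U s)).
  by apply/funext => s; exact: E.
rewrite (@derive_shear _ f U k (fun=> x) U t 1 fs Us ks (@smooth_cst _ _ _ x)
  Us).
by rewrite (derive_cst (x : R)) mul0r add0r.
Qed.

Lemma is_derive_pair V W (f : R -> V) (g : R -> W) t df dg :
  is_derive t (1 : R) f df -> is_derive t (1 : R) g dg ->
  is_derive t (1 : R) (fun s => (f s, g s)) (df, dg).
Proof.
move=> [/derivable1_diffP df1 <-] [/derivable1_diffP dg1 <-].
have dd : differentiable (fun s => (f s, g s)) t by exact: differentiable_pair.
by split; [exact: diff_derivable|rewrite !deriveE // diff_pair].
Qed.

Lemma Ck_sin_cos n : Ck n (@sin R) /\ Ck n (@cos R).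
Proof.
elim: n => [|n [IHs IHc]]; first by split;
  [exact: continuous_sin|exact: continuous_cos].
split; first exact: (Ck_real (@is_derive_sin R)).
apply: (Ck_real (@is_derive_cos R)).
have -> : (fun x : R => - sin x) = (fun x => (-1) * sin x) by apply/funext => x;
  rewrite mulN1r.
by apply: Ck_mul => //; exact: Ck_cst.
Qed.

(* [k] replaces time as the factor of the generating function: as it is bounded,
   the implicit equations remain solvable for all times. *)
Lemma bounded_time (e : R) : 0 < e -> exists k : R -> R,
  [/\ smooth k, k 0 = 0, 'D_1 k 0 = 1 & forall t, `|k t| <= e].
Proof.
move=> e0; exists (fun t => e * sin (e^-1 * t)); split.
- apply: smoothM; first exact: smooth_cst.
  apply: (smooth_comp fin_basisR (g := sin)); first by smth.
  by move=> n; case: (Ck_sin_cos n).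
- by rewrite mulr0 sin0 mulr0.
- have d1 : is_derive (0 : R) (1 : R) (fun t => e^-1 * t) e^-1.
    have := is_deriveM (is_derive_cst e^-1 (0 : R) (1 : R))
      (is_derive_id (0 : R) (1 : R)).
    by rewrite /GRing.scale /= mulr1 mulr0 addr0.
  have d2 := @is_derive1_comp _ sin (fun t => e^-1 * t) 0 _ _ (is_derive_sin _)
    d1.
  have := is_deriveM (is_derive_cst e (0 : R) (1 : R)) d2.
  rewrite /GRing.scale /= mulr0 cos0 mul1r mulr0 addr0 mulfV ?gt_eqF // => d3.
  by case: d3 => _; exact.
- move=> t; rewrite normrM gtr0_norm // ler_piMr ?(ltW e0) //.
  by rewrite ler_norml sin_geN1 sin_le1.
Qed.

End PlaneDerivatives.

(** The linear algebra behind Hamilton's equations. Here [y'] is the velocity of the final ordinate,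
    [a] and [b] are the partial derivatives of the initial abscissa with respect to the final point,
    and [sx] to [syy] are derivatives of S. The conclusions identify the velocity with the
    Hamiltonian field of k' S(x, Y) as a function of the final point; each is checked after
    multiplication by 1 + k sxy. *)
Lemma solve_isotopy (F : fieldType) (k k' sx sy sxy syy a b y' : F) :
  1 + k * sxy != 0 ->
  0 = y' + (k' * sx + k * (y' * sxy)) ->
  1 = a + k * (a * sxy) -> 0 = b + k * (b * sxy + syy) ->
  k' * sy + k * (y' * syy) = k' * (b * sx + sy) /\ y' = - (k' * (a * sx)).
Proof.
move=> D0 h1 h2 h3.
have h1' : y' * (1 + k * sxy) = - (k' * sx) by apply/eqP;
  rewrite -subr_eq0 {1}h1; apply/eqP; ring.
split; apply: (mulIf D0).
  have E1 : (k' * sy + k * (y' * syy)) * (1 + k * sxy) =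
    k' * sy * (1 + k * sxy) + k * syy * (y' * (1 + k * sxy)) by ring.
  have E2 : k' * (b * sx + sy) * (1 + k * sxy) = k' * sy * (1 + k * sxy) +
    k' * sx * (b + k * (b * sxy + syy)) - k' * sx * k * syy by ring.
  by rewrite E1 E2 h1' -h3; ring.
have E3 : - (k' * (a * sx)) * (1 + k * sxy) = - (k' * sx) * (a + k * (a * sxy))
  by ring.
by rewrite h1' E3 -h2 mulr1.
Qed.

Section GeneratingFunction.
Context {R : realType} (S : plane R -> R) (ST : test_function S).

Let Sx := 'D_ex S.
Let Sy := 'D_ey S.

(** One relation between p and q is solved in two ways: for the final ordinate given p, which
    defines the isotopy, and for the initial abscissa given q, which defines its inverse. The
    implicit equations stay in the conclusion because the preserved sets are read off from them. *)
Lemma generating_isotopy : exists phi H (k : R -> R),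
  [/\ ham_isotopy phi H, H 0 = S,
      (forall t p q, phi t p = q <->
        p.2 = q.2 + k t * Sx (p.1, q.2) /\ q.1 = p.1 + k t * Sy (p.1, q.2)) &
      exists2 K : set (plane R), compact K & forall t p, ~ K p -> phi t p = p].
Proof.
have Ss : smooth S by case: ST.
have [Sxs Sys] : smooth Sx /\ smooth Sy by split; exact: smooth_derive.
have [M M0 SM] := test_function_bounded (test_function_derive ey
  (test_function_derive ex ST)).
(* With |k| <= e this gives |k S_xy| <= 1/2, so both equations have a partial derivative of at least
   1/2 in their unknown. *)
have [e e0 eM] : exists2 e : R, 0 < e & e * M <= 1 / 2.
  exists (1 / (2 * M)); first by rewrite divr_gt0 // mulr_gt0.
  by rewrite le_eqVlt; apply/orP; left; apply/eqP; field; rewrite gt_eqF.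
have [k [ks k0 k'0 ke]] := bounded_time e0.
have Sxy q : 'D_ex Sy q = 'D_ey Sx q by rewrite /Sx /Sy schwarz.
have Dge t q : 1 / 2 <= 1 + k t * 'D_ey Sx q.
  have h : `|k t * 'D_ey Sx q| <= 1 / 2.
    by rewrite normrM; apply: le_trans eM; apply: ler_pM => //; exact: SM.
  by move: h; rewrite ler_norml => /andP[h _]; lra.
pose F1 (z : (R * R) * R) := z.2 + k z.1.1 * Sx (z.1.2, z.2).
pose F2 (z : (R * R) * R) := z.2 + k z.1.1 * Sy (z.2, z.1.2).
have bRR : fin_basis (R * R)%type by apply: fin_basis_prod; exact: fin_basisR.
have bRRR : fin_basis ((R * R) * R)%type by apply: fin_basis_prod => //;
  exact: fin_basisR.
have F1s : smooth F1.
  apply: smoothD; first exact: smooth_snd.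
  apply: smoothM; first by apply: (smooth_comp fin_basisR _ ks); smth.
  by apply: (smooth_comp fin_basis_plane _ Sxs); smth.
have F2s : smooth F2.
  apply: smoothD; first exact: smooth_snd.
  apply: smoothM; first by apply: (smooth_comp fin_basisR _ ks); smth.
  by apply: (smooth_comp fin_basis_plane _ Sys); smth.
have kz : smooth (fun z : (R * R) * R => k z.1.1).
  by apply: (smooth_comp fin_basisR _ ks); smth.
have D1 (z : (R * R) * R) : 'D_(0, 1) (fun z : (R * R) * R => z.2) z = 1 :> R.
  by apply: derive_affine.
have D2 (z : (R * R) * R) : 'D_(0, 1) (fun z : (R * R) * R => z.1.2) z = 0 :> R.
  by apply: derive_affine => s; rewrite scaler0 /= [s *: _]scaler0.
have D3 (z : (R * R) * R) : 'D_(0, 1) (fun z : (R * R) * R => k z.1.1) z =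
  0 :> R.
  apply: derive_affine => s; rewrite scaler0 addr0; congr k.
  by rewrite /= [s *: _]scaler0 addr0.
have F1' z : 1 / 2 <= 'D_(0, 1) F1 z.
  rewrite /F1 (@derive_shear _ _ Sx (fun z => z.2) (fun z => k z.1.1) (fun z =>
    z.1.2) (fun z => z.2)) //; try by smth.
  apply: le_trans (Dge z.1.1 (z.1.2, z.2)) _.
  by rewrite D1 D2 D3 !mul0r mul1r !add0r.
have F2' z : 1 / 2 <= 'D_(0, 1) F2 z.
  rewrite /F2 (@derive_shear _ _ Sy (fun z => z.2) (fun z => k z.1.1) (fun z =>
    z.2) (fun z => z.1.2)) //; try by smth.
  apply: le_trans (Dge z.1.1 (z.2, z.1.2)) _.
  by rewrite D1 D2 D3 !mul0r mul1r !addr0 add0r Sxy.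
have [G1 [G1s G1E G1K]] := implicit_function bRR F1s F1'.
have [G2 [G2s G2E G2K]] := implicit_function bRR F2s F2'.
pose phi t (p : plane R) : plane R :=
  (p.1 + k t * Sy (p.1, G1 ((t, p.1), p.2)), G1 ((t, p.1), p.2)).
pose psi t (q : plane R) : plane R :=
  (G2 ((t, q.2), q.1), q.2 + k t * Sx (G2 ((t, q.2), q.1), q.2)).
pose H t (q : plane R) := 'D_1 k t * S (G2 ((t, q.2), q.1), q.2).
have phiE t p q : phi t p = q <->
    p.2 = q.2 + k t * Sx (p.1, q.2) /\ q.1 = p.1 + k t * Sy (p.1, q.2).
  split=> [<- /=|[h1 h2]].
    by split => //; rewrite -[LHS](G1E (t, p.1)).
  have -> : phi t p = (p.1 + k t * Sy (p.1, q.2), q.2).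
    by rewrite /phi h1 -[q.2 + _]/(F1 ((t, p.1), q.2)) G1K.
  by rewrite -h2 -surjective_pairing.
have psiE t p q : psi t q = p <->
    p.2 = q.2 + k t * Sx (p.1, q.2) /\ q.1 = p.1 + k t * Sy (p.1, q.2).
  split=> [<- /=|[h1 h2]].
    by split => //; rewrite -[LHS](G2E (t, q.2)).
  have -> : psi t q = (p.1, q.2 + k t * Sx (p.1, q.2)).
    by rewrite /psi h2 -[p.1 + _]/(F2 ((t, q.2), p.1)) G2K.
  by rewrite -h1 -surjective_pairing.
have [M1 M10 SM1] := test_function_box ST.
have Mbox v q : ~ box 0 M1 q -> 'D_v S q = 0.
  move=> nq; apply/eqP; apply: contra_notT nq.
  apply: (derive_neq0_compact (@compact_box _ 0 M1)) => p Sp.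
  by apply/boxP; rewrite subr0 leNgt; apply: contra_neqN Sp; exact: SM1.
have [M2 M20 SM2] := test_function_bounded (test_function_derive ey ST).
(* Where the Hamiltonian is nonzero, (x, Y) lies in the box of radius M1 containing the support of
   S, and the final abscissa differs from x by k S_Y, at most e M2. *)
pose K := box (0 : plane R) (M1 + e * M2).
have eM2 : 0 <= e * M2 by rewrite mulr_ge0 ?ltW.
have box1K q : box 0 M1 q -> K q.
  by move=> /boxP qM; apply/boxP; rewrite (le_trans qM) // lerDl.
exists phi, H, k; split => //; first last.
- exists K; first exact: compact_box.
  move=> t p Kp; apply/phiE; rewrite -surjective_pairing /Sx /Sy !Mbox ?mulr0
    ?addr0 //.
    by move=> /box1K.
  by move=> /box1K.
- apply/funext => q; rewrite /H k'0 mul1r; congr S.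
  rewrite [RHS]surjective_pairing; congr pair.
  by rewrite -[RHS](G2K (0, q.2)) /F2 /= k0 mul0r addr0.
split.
- rewrite /phi; apply: smooth_pair.
    apply: smoothD; first by smth.
    apply: smoothM; first by apply: (smooth_comp fin_basisR _ ks); smth.
    apply: (smooth_comp fin_basis_plane _ Sys); apply: smooth_pair;
      first by smth.
    by apply: (smooth_comp bRRR _ G1s); smth.
  by apply: (smooth_comp bRRR _ G1s); smth.
- exists psi; split => [|t].
    have g2 : smooth (fun z : R * plane R => G2 ((z.1, z.2.2), z.2.1)).
      by apply: (smooth_comp bRRR _ G2s); smth.
    rewrite /psi; apply: smooth_pair => //.
    apply: smoothD; first by smth.
    apply: smoothM; first by apply: (smooth_comp fin_basisR _ ks); smth.
    by apply: (smooth_comp fin_basis_plane _ Sxs); apply: smooth_pair => //;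
      smth.
  by split=> p; [apply/psiE/phiE|apply/phiE/psiE].
- by apply/funext => p; apply/phiE; rewrite k0 !mul0r !addr0.
- rewrite /H; apply: smoothM.
    apply: (smooth_comp fin_basisR (g := 'D_1 k));
      [by smth|exact: smooth_derive].
  apply: (smooth_comp fin_basis_plane _ Ss); apply: smooth_pair; last by smth.
  by apply: (smooth_comp bRRR _ G2s); smth.
- exists K; first exact: compact_box.
  move=> t q; apply: contra_notP => /eqP; rewrite mulf_eq0 negb_or =>
    /andP[_ Sq].
  have /psiE[_ h2] := erefl (psi t q).
  have : `|(G2 (t, q.2, q.1), q.2) : plane R| <= M1.
    by rewrite leNgt; apply: contra_neqN Sq; exact: SM1.
  rewrite prod_normE /= ge_max => /andP[h3 h4].
  apply/boxP; rewrite subr0 prod_normE /= ge_max; apply/andP; split; last first.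
    by rewrite (le_trans h4) // lerDl.
  rewrite h2 (le_trans (ler_normD _ _)) // lerD // normrM.
  by apply: ler_pM => //; exact: SM2.
- move=> t p; set q := phi t p; set x := p.1; set y := p.2.
  have [h1 h2] := (phiE t p q).1 erefl.
  have E2 : G2 ((t, q.2), q.1) = x.
    have Ep : psi t q = p by exact/psiE.
    exact: (congr1 fst Ep).
  pose U s := G1 ((s, x), y); pose X (r : plane R) := G2 ((t, r.2), r.1).
  have Us : smooth U by apply: (smooth_comp bRRR _ G1s); smth.
  have Xs : smooth X by apply: (smooth_comp bRRR _ G2s); smth.
  have Uq : U t = q.2 by [].
  have Xq : X q = x by [].
  have U' : 0 = 'D_1 U t + ('D_1 k t * Sx (x, q.2) +
    k t * ('D_1 U t * 'D_ey Sx (x, q.2))).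
    rewrite -Uq; apply: (derive_implicit_time (y := y)) => // s.
    by rewrite -[LHS](G1E (s, x)).
  have X' w : w.1 = 'D_w X q + k t * ('D_w X q * 'D_ey Sx (x, q.2) +
    w.2 * 'D_ey Sy (x, q.2)).
    rewrite -Sxy -Xq; apply: derive_implicit_space => // r.
    by rewrite -[LHS](G2E (t, r.2)).
  have Hw w : 'D_w (H t) q = 'D_1 k t * ('D_w X q * Sx (x, q.2) +
    w.2 * Sy (x, q.2)).
    by rewrite -Xq -derive_graph.
  have D0 : 1 + k t * 'D_ey Sx (x, q.2) != 0.
    by rewrite gt_eqF // (lt_le_trans _ (Dge _ _)).
  have Xex : 1 = 'D_ex X q + k t * ('D_ex X q * 'D_ey Sx (x, q.2)).
    by have := X' ex; rewrite /= mul0r addr0.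
  have Xey : 0 = 'D_ey X q + k t * ('D_ey X q * 'D_ey Sx (x, q.2) +
    'D_ey Sy (x, q.2)).
    by have := X' ey; rewrite /= mul1r.
  have [h3 h4] := @solve_isotopy _ (k t) ('D_1 k t) (Sx (x, q.2)) (Sy (x, q.2))
    ('D_ey Sx (x, q.2)) ('D_ey Sy (x, q.2)) _ _ _ D0 U' Xex Xey.
  rewrite /ham_vf !Hw /= mul0r mul1r addr0 -h3 -h4.
  apply: is_derive_pair; split; first 1 last.
  - by rewrite -Uq -(derive_time x x t Sys ks Us).
  - exact: smooth_derivable.
  - by [].
  apply: smooth_derivable; apply: smoothD; first by smth.
  by apply: smoothM => //; apply: (smooth_comp fin_basis_plane _ Sys); smth.
Qed.

End GeneratingFunction.

(** * The group of Hamiltonian diffeomorphisms *)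

Section HamiltonianGroup.
Context {R : realType}.
Implicit Types (phi psi : plane R -> plane R) (h : plane R -> R).

Lemma is_derive_diff (V W : normedModType R) (f : R -> V) (g : V -> W) t f' :
  differentiable g (f t) -> is_derive t (1 : R) f f' ->
  is_derive t (1 : R) (fun s => g (f s)) ('d g (f t) f').
Proof.
move=> dg [/derivable1_diffP df <-].
have dgf : differentiable (fun s => g (f s)) t by exact:
  (differentiable_comp df dg).
by split; [exact: diff_derivable|rewrite !deriveE // (diff_comp df dg)].
Qed.

Lemma is_derive_reparam (W : normedModType R) (f : R -> W) (g : R -> R) t f'
  g' :
  is_derive (g t) (1 : R) f f' -> is_derive t (1 : R) g g' ->
  is_derive t (1 : R) (fun s => f (g s)) (g' *: f').
Proof.
move=> [/derivable1_diffP df <-] dg.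
have -> : g' *: 'D_1 f (g t) = 'd f (g t) g'.
  by rewrite deriveE // -linearZ /=; congr ('d f _ _); exact: mulr1.
exact: is_derive_diff.
Qed.

Lemma ham_vfZ a h p : smooth h -> ham_vf (fun q => a * h q) p = a *: ham_vf h p.
Proof.
move=> hs; have E v : 'D_v (fun q => a * h q) p = a * 'D_v h p.
  by rewrite (deriveZ a (smooth_derivable hs)).
by rewrite /ham_vf !E; congr pair; rewrite /= [RHS]mulrN.
Qed.

Lemma ham_vfD g h p : smooth g -> smooth h ->
  ham_vf (fun q => g q + h q) p = ham_vf g p + ham_vf h p.
Proof.
move=> gs hs; have E v : 'D_v (fun q => g q + h q) p = 'D_v g p + 'D_v h p.
  by rewrite (deriveD (smooth_derivable gs) (smooth_derivable hs)).
by rewrite /ham_vf !E; congr pair; rewrite /= opprD.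
Qed.

Lemma ham_vf_cst (c : R) p : ham_vf (fun=> c) p = 0.
Proof.
by rewrite /ham_vf !(derive_cst (c : R)) oppr0.
Qed.

Lemma smooth_slice (F : R * plane R -> R) t : smooth F ->
  smooth (fun p => F (t, p)).
Proof. by move=> Fs; apply: (smooth_comp fin_basis_Rplane _ Fs); smth. Qed.

Lemma smooth_slice2 (F : R * plane R -> plane R) t : smooth F ->
  smooth (fun p => F (t, p)).
Proof. by move=> Fs; apply: (smooth_comp2 fin_basis_Rplane _ Fs); smth. Qed.

(** Precomposition with a fixed diffeomorphism leaves the Hamiltonian unchanged, and a change of
    time multiplies it by a'. Rescaling of time and inversion are both instances. *)
Lemma ham_isotopy_reparam Phi H (a : R -> R) chi chi' : ham_isotopy Phi H ->
  smooth a -> smooth chi -> smooth chi' -> cancel chi chi' -> cancel chi' chi ->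
  (forall p, Phi (a 0) (chi p) = p) ->
  ham_isotopy (fun t p => Phi (a t) (chi p)) (fun t p => 'D_1 a t * H (a t) p).
Proof.
move=> [Ps [Psi [Psis PK]] P0 Hs [K Kc HK] Pf] sa cs c's chiK chi'K start.
have az : smooth (fun z : R * plane R => a z.1).
  by apply: (smooth_comp fin_basisR _ sa); smth.
have cz (f : plane R -> plane R) : smooth f -> smooth (fun z : R * plane R =>
  f z.2).
  by move=> fs; apply: (smooth_comp2 fin_basis_plane _ fs); smth.
split.
- apply: (smooth_comp2 fin_basis_Rplane (f := fun z : R * plane R =>
    (a z.1, chi z.2)) _ Ps).
  by apply: smooth_pair => //; exact: cz.
- exists (fun t p => chi' (Psi (a t) p)); split.
    apply: (smooth_comp2 fin_basis_plane _ c's).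
    apply: (smooth_comp2 fin_basis_Rplane (f := fun z : R * plane R =>
      (a z.1, z.2)) _ Psis).
    by apply: smooth_pair => //; smth.
  by move=> t; have [h1 h2] := PK (a t); split=> p;
    rewrite ?h1 ?chiK ?chi'K ?h2.
- by apply/funext => p; rewrite start.
- apply: smoothM.
    by apply: (smooth_comp fin_basisR (g := 'D_1 a));
      [smth|exact: smooth_derive].
  apply: (smooth_comp fin_basis_Rplane (f := fun z : R * plane R =>
    (a z.1, z.2)) _ Hs).
  by apply: smooth_pair => //; smth.
- by exists K => // t p /HK ->; rewrite mulr0.
- move=> t p; rewrite ham_vfZ; last first.
    exact: (@smooth_slice (fun z => H z.1 z.2) (a t) Hs).
  have da : is_derive t (1 : R) a ('D_1 a t) by split => //;
    exact: smooth_derivable.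
  exact: (@is_derive_reparam _ (fun s => Phi s (chi p)) a t _ _
    (Pf (a t) (chi p)) da).
Qed.

(** Rescaling time by the factor t brings the map at any time, negative ones included, to time 1. *)
Lemma ham_isotopy_Ham_c (Phi : R -> plane R -> plane R) H t :
  ham_isotopy Phi H -> Ham_c (Phi t).
Proof.
move=> HP; exists (fun s p => Phi (s * t) p),
  (fun s p => 'D_1 (fun u : R => u * t) s * H (s * t) p).
split; last by apply/funext => p; rewrite mul1r.
apply: (@ham_isotopy_reparam _ _ (fun u : R => u * t) id id) => //; try by smth.
by move=> p; rewrite mul0r; have [_ _ ->] := HP.
Qed.

Lemma Ham_c_id : Ham_c (@id (plane R)).
Proof.
exists (fun _ p => p), (fun _ _ => 0); split => //; split => //; try by smth.
- by exists (fun _ p => p); split => //; smth.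
- by exists set0 => //; exact: compact0.
- move=> t p; rewrite ham_vf_cst; exact: is_derive_cst.
Qed.

(** The path run backwards, Phi (1 - s) after the inverse of Phi 1, leads from the identity to that
    inverse and is driven by - H (1 - s). *)
Lemma Ham_c_inv phi : Ham_c phi ->
  exists2 psi, Ham_c psi & cancel phi psi /\ cancel psi phi.
Proof.
move=> [Phi [H [HP <-]]]; have [Ps [Psi [Psis PK]] P0 _ _ _] := HP.
have [P1 P2] := PK 1.
exists (Psi 1) => //.
exists (fun s p => Phi (1 - s) (Psi 1 p)), (fun s p => 'D_1 (fun u : R => 1 - u)
  s * H (1 - s) p).
split; last by apply/funext => p; rewrite subrr P0.
apply: (@ham_isotopy_reparam _ _ (fun u : R => 1 - u) _ (Phi 1)) => //;
  first by smth.
- exact: (@smooth_slice2 (fun z => Psi z.1 z.2) 1 Psis).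
- exact: (@smooth_slice2 (fun z => Phi z.1 z.2) 1 Ps).
- by move=> p; rewrite subr0 P2.
Qed.

(* Concatenate: run [psi] during [0, 1/4], then [phi] during [3/4, 1]. *)
Lemma Ham_c_comp phi psi : Ham_c phi -> Ham_c psi -> Ham_c (phi \o psi).
Proof.
move=> [Phi [H [HP <-]]] [Psi [L [LP <-]]].
have [Ps [Phi' [Phi's PK]] P0 Hs [K Kc HK] Pf] := HP.
have [Qs [Psi' [Psi's QK]] Q0 Ls [M Mc LM] Qf] := LP.
pose a (t : R) := step (4 * t - 3); pose b (t : R) := step (4 * t).
have sa : smooth a by apply: (smooth_comp fin_basisR _ smooth_step); smth.
have sb : smooth b by apply: (smooth_comp fin_basisR _ smooth_step); smth.
have a0 t : t <= 3 / 4 -> a t = 0 by move=> t1; rewrite /a step0 //; lra.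
have b1 t : 1 / 4 <= t -> b t = 1 by move=> t1; rewrite /b step1 //; lra.
have az : smooth (fun z : R * plane R => a z.1) by apply:
  (smooth_comp fin_basisR _ sa); smth.
have bz : smooth (fun z : R * plane R => b z.1) by apply:
  (smooth_comp fin_basisR _ sb); smth.
have fam (F : R -> plane R -> plane R) (c : R -> R) (f : R * plane R ->
  plane R) :
    smooth (fun z : R * plane R => F z.1 z.2) -> smooth (fun z : R * plane R =>
      c z.1) ->
    smooth f -> smooth (fun z : R * plane R => F (c z.1) (f z)).
  move=> Fs cs fs.
  by apply: (smooth_comp2 fin_basis_Rplane (f := fun z : R * plane R =>
    (c z.1, f z)) _ Fs); smth.
have famH (F : R -> plane R -> R) (c : R -> R) :
    smooth (fun z : R * plane R => F z.1 z.2) -> smooth c ->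
    smooth (fun z : R * plane R => 'D_1 c z.1 * F (c z.1) z.2).
  move=> Fs cs; apply: smoothM.
    by apply: (smooth_comp fin_basisR (g := 'D_1 c));
      [smth|exact: smooth_derive].
  apply: (smooth_comp fin_basis_Rplane (f := fun z : R * plane R =>
    (c z.1, z.2)) _ Fs).
  by apply: smooth_pair; [apply: (smooth_comp fin_basisR _ cs)|]; smth.
exists (fun t p => Phi (a t) (Psi (b t) p)).
exists (fun t p => 'D_1 a t * H (a t) p + 'D_1 b t * L (b t) p).
split; last first.
  by apply/funext => p; rewrite /a /b !step1 //; lra.
split.
- apply: (fam) => //; apply: (fam) => //; smth.
- exists (fun t p => Psi' (b t) (Phi' (a t) p)); split.
    by apply: (fam) => //; apply: (fam) => //; smth.
  move=> t; have [h1 h2] := PK (a t); have [h3 h4] := QK (b t).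
  by split=> p; rewrite ?h1 ?h3 ?h4 ?h2.
- apply/funext => p; rewrite a0; last by lra.
  by rewrite P0 /b step0 ?Q0 //; lra.
- by apply: smoothD; apply: famH.
- exists (K `|` M); first exact: compactU.
  by move=> t p /not_orP[/HK -> /LM ->]; rewrite !mulr0 addr0.
- move=> t p.
  have da : is_derive t (1 : R) a ('D_1 a t) by split => //;
    exact: smooth_derivable.
  have db : is_derive t (1 : R) b ('D_1 b t) by split => //;
    exact: smooth_derivable.
  have sH c : smooth (fun q => H c q) by exact:
    (@smooth_slice (fun z => H z.1 z.2) c Hs).
  have sL c : smooth (fun q => L c q) by exact:
    (@smooth_slice (fun z => L z.1 z.2) c Ls).
  have sZ (F : plane R -> R) (c : R) : smooth F -> smooth (fun q => c * F q).
    by move=> Fs; apply: smoothM => //; exact: smooth_cst.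
  rewrite ham_vfD ?ham_vfZ //; try exact: sZ.
  (* At every time one factor is locally constant in time: either a = 0 near t, where Phi is the
     identity, or b = 1 near t. Hence the velocity comes from a single Hamiltonian. *)
  have [t34|t34] := ltP t (3 / 4).
    have na : \forall s \near t, a s = 0.
      by near=> s; apply: a0; apply: ltW; near: s; exact: lt_nbhsl.
    have -> : 'D_1 a t = 0.
      by apply: derive_cst_near; near=> s; rewrite [RHS]a0 ?(ltW t34) //;
        near: s; exact: na.
    rewrite scale0r add0r a0 ?(ltW t34) // P0.
    apply: (near_eq_is_derive (f := fun s => Psi (b s) p)).
      by near=> s; rewrite (near na s) // P0.
    exact: (@is_derive_reparam _ (fun s => Psi s p) b t _ _ (Qf (b t) p) db).
  have t14 : 1 / 4 < t by lra.
  have nb : \forall s \near t, b s = 1.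
    by near=> s; apply: b1; apply: ltW; near: s; exact: lt_nbhsr.
  have -> : 'D_1 b t = 0.
    by apply: derive_cst_near; near=> s; rewrite [RHS]b1 ?(ltW t14) //; near: s;
      exact: nb.
  rewrite scale0r addr0 b1 ?(ltW t14) //.
  apply: (near_eq_is_derive (f := fun s => Phi (a s) (Psi 1 p))).
    by near=> s; rewrite (near nb s).
  exact: (@is_derive_reparam _ (fun s => Phi s (Psi 1 p)) a t _ _
    (Pf (a t) (Psi 1 p)) da).
Unshelve. all: by end_near. Qed.

Lemma stabilizer_subgroup (C : set (plane R)) :
  subgroup_of_Ham_c (curve_stabilizer C).
Proof.
split.
- by move=> phi [].
- by split; [exact: Ham_c_id|rewrite image_id].
- move=> phi psi [h1 h2] [h3 h4]; split; first exact: Ham_c_comp.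
  by rewrite -image_comp h4 h2.
- move=> phi [h1 h2]; have [psi h3 [K1 K2]] := Ham_c_inv h1.
  exists psi => //; split => //; rewrite -{1}h2 image_comp.
  by rewrite (_ : psi \o phi = id) ?image_id //; apply/funext => p /=;
    rewrite K1.
Qed.

End HamiltonianGroup.

(** * Curves of diffeomorphisms preserving a set *)

Section LieAlgebra.
Context {R : realType}.
Implicit Types (h g : plane R -> R) (C : set (plane R)).

Lemma derive_slice (F : R * plane R -> plane R) t p : smooth F ->
  'D_(1, 0) F (t, p) = 'D_1 (fun s => F (s, p)) t.
Proof.
move=> Fs.
have E (s : R) : (t, p) + (s - t) *: (1, 0) = (s, p) :> R * plane R.
  congr pair; first by rewrite /= [_ *: 1]mulr1 subrKC.
  by rewrite /= scaler0 addr0.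
have d0 : differentiable F ((t, p) + (t - t) *: (1, 0)) by exact: smooth_diff.
have := is_derive_line d0; rewrite subrr scale0r addr0 => d1.
have dt : is_derive t (1 : R) (fun s : R => s - t) 1.
  have := is_deriveB (is_derive_id t (1 : R)) (is_derive_cst t t (1 : R)).
  by rewrite subr0.
rewrite -(subrr t) in d1.
have := @is_derive_reparam _ _ (fun s => F ((t, p) + s *: (1, 0))) (fun s =>
  s - t) t _ _ d1 dt.
rewrite scale1r; have -> : (fun s => F ((t, p) + (s - t) *: (1, 0))) =
  (fun s => F (s, p)).
  by apply/funext => s; rewrite E.
by move=> [_ d2]; exact: esym d2.
Qed.

(** The pointwise product of two curves through the identity has the sum of their velocities as
    initial velocity. This is what lets a Hamiltonian be treated piece by piece. *)
Lemma lie_algebra_add (G : set (plane R -> plane R)) g h :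
  (forall phi psi, G phi -> G psi -> G (phi \o psi)) ->
  lie_algebra_of G g -> lie_algebra_of G h ->
  lie_algebra_of G (fun p => g p + h p).
Proof.
move=> Gcomp [[gs gc] [c [cs cG cK c0 c']]] [[hs hc] [d [ds dG dK d0 d']]];
  split.
  apply: (@test_functionS _ _ (closure [set p | g p != 0] `|` closure
    [set p | h p != 0])).
  - exact: smoothD.
  - exact: compactU.
  - move=> p; have [->|gp] := eqVneq (g p) 0.
      by rewrite add0r => hp; right; exact: subset_closure.
    by move=> _; left; exact: subset_closure.
exists (fun t p => c t (d t p)); split.
- apply: (smooth_comp2 fin_basis_Rplane (f := fun z : R * plane R =>
    (z.1, d z.1 z.2)) _ cs).
  by smth.
- by move=> t; exact: (Gcomp (c t) (d t)).
- move=> T; have [K Kc cKT] := cK T; have [L Lc dLT] := dK T.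
  exists (K `|` L); first exact: compactU.
  by move=> t p tT /not_orP[Kp Lp]; rewrite dLT // cKT.
- by rewrite c0 d0.
- move=> p.
  pose F (z : R * plane R) := c z.1 z.2.
  have Fd : differentiable F (0, p) by exact: smooth_diff.
  have d1 : is_derive (0 : R) (1 : R) (fun t => (t, d t p)) (1, ham_vf h p).
    by apply: is_derive_pair.
  have dp : d 0 p = p by rewrite d0.
  have := @is_derive_diff _ _ _ (fun t => (t, d t p)) F 0 _ _ d1.
  rewrite dp => /(_ Fd) d2; apply: (is_derive_eq d2).
  (* The first summand gives the time derivative of c at the fixed point p, the second the space
     derivative of c 0 = id applied to the velocity of d. *)
  have -> : (1, ham_vf h p) = (1, 0) + (0, ham_vf h p) :> R * plane R.
    by congr pair; rewrite /= ?addr0 ?add0r.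
  rewrite linearD /= -!deriveE // ham_vfD //; congr (_ + _).
    by rewrite derive_slice //; case: (c' p).
  apply: derive_affine => s; rewrite /F /= scaler0 addr0 c0 //.
Qed.

Lemma lie_algebra_zero (G : set (plane R -> plane R)) : G id ->
  lie_algebra_of G (fun=> 0).
Proof.
move=> Gid; split.
  by apply: (@test_functionS _ _ set0);
    [exact: smooth_cst|exact: compact0|move=> p; rewrite eqxx].
exists (fun _ p => p); split => //; first by smth.
- by move=> T; exists set0 => //; exact: compact0.
- by move=> p; rewrite ham_vf_cst; exact: is_derive_cst.
Qed.

Lemma diff_compE (U V W : normedModType R) (f : U -> V) (g : V -> W) x v :
  differentiable f x -> differentiable g (f x) ->
  'd (fun y => g (f y)) x v = 'd g (f x) ('d f x v).
Proof. by move=> df dg; rewrite -[RHS]/(('d g (f x) \o 'd f x) v)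
  -(diff_comp df dg). Qed.

Lemma diff_cancel (f g : plane R -> plane R) : smooth f -> smooth g ->
  cancel f g -> forall q w, 'd g (f q) ('d f q w) = w.
Proof.
move=> fs gs fK q w.
have df : differentiable f q by exact: smooth_diff.
have dg : differentiable g (f q) by exact: smooth_diff.
have E := diff_comp df dg; rewrite (_ : g \o f = id) in E; last first.
  by apply/funext => p /=; rewrite fK.
have [_ Eid] := is_diff_id q.
by rewrite -[LHS]/(('d g (f q) \o 'd f q) w) -E Eid.
Qed.

(** * Transport by a symplectic diffeomorphism of the plane *)

Section Conjugation.
Context (sigma tau : plane R -> plane R).
Context (ss : smooth sigma) (ts : smooth tau)
  (sK : cancel sigma tau) (tK : cancel tau sigma)
  (symplectic : forall q v w, omega ('d sigma q v) ('d sigma q w) = omega v w).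

Let dtau_dsigma q w : 'd tau (sigma q) ('d sigma q w) = w.
Proof. exact: diff_cancel. Qed.

Let dsigma_dtau q v : 'd sigma q ('d tau (sigma q) v) = v.
Proof. by have := diff_cancel ts ss tK (sigma q) v; rewrite sK. Qed.

Lemma smooth_conj h : smooth h -> smooth (fun p => h (tau p)).
Proof. by move=> hs; exact: (smooth_comp fin_basis_plane ts hs). Qed.

(** Both sides have the same omega-pairing with every v, written as the image under the differential
    of sigma of a vector at q; testing on [ex] and [ey] recovers the components. *)
Lemma ham_vf_conj h q : smooth h ->
  ham_vf (fun p => h (tau p)) (sigma q) = 'd sigma q (ham_vf h q).
Proof.
move=> hs.
have dh : differentiable h (tau (sigma q)) by exact: smooth_diff.
have dt : differentiable tau (sigma q) by exact: smooth_diff.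
have dht : differentiable (fun p => h (tau p)) (sigma q) by apply: smooth_diff;
  exact: smooth_conj.
have E v : omega (ham_vf (fun p => h (tau p)) (sigma q)) v =
  omega ('d sigma q (ham_vf h q)) v.
  rewrite -[v in RHS](dsigma_dtau q) symplectic !omega_ham_vf //; last exact:
    smooth_diff.
  by apply: (etrans (diff_compE v dt dh)); rewrite sK.
move: (E ex) (E ey); rewrite /omega /= !mulr0 !mulr1 !subr0 !sub0r.
by move=> /oppr_inj h2 h1; rewrite [RHS]surjective_pairing -h1 -h2.
Qed.

Lemma Ham_c_conj phi : Ham_c phi -> Ham_c (sigma \o phi \o tau).
Proof.
move=> [Phi [H [[Ps [Psi [Psis PK]] P0 Hs [K Kc HK] Pf] <-]]].
exists (fun t p => sigma (Phi t (tau p))), (fun t p => H t (tau p));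
  split => //.
have fam (F : R -> plane R -> plane R) : smooth (fun z : R * plane R =>
  F z.1 z.2) ->
    smooth (fun z : R * plane R => sigma (F z.1 (tau z.2))).
  move=> Fs; apply: (smooth_comp2 fin_basis_plane _ ss).
  apply: (smooth_comp2 fin_basis_Rplane (f := fun z : R * plane R =>
    (z.1, tau z.2)) _ Fs).
  by apply: smooth_pair; [smth|apply: (smooth_comp2 fin_basis_plane _ ts);
    smth].
split.
- exact: fam.
- exists (fun t p => sigma (Psi t (tau p))); split; first exact: fam.
  by move=> t; have [h1 h2] := PK t; split=> p; rewrite sK ?h1 ?h2 tK.
- by apply/funext => p; rewrite P0 tK.
- apply: (smooth_comp fin_basis_Rplane (f := fun z : R * plane R =>
    (z.1, tau z.2)) _ Hs).
  by apply: smooth_pair; [smth|apply: (smooth_comp2 fin_basis_plane _ ts);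
    smth].
- exists (sigma @` K).
    by apply: continuous_compact => //; apply: continuous_subspaceT;
      exact: smooth_continuous.
  by move=> t p Kp; apply: HK => Kt; apply: Kp; exists (tau p).
- move=> t p; rewrite ham_vf_conj; last exact:
    (@smooth_slice _ (fun z => H z.1 z.2) t Hs).
  by apply: (@is_derive_diff _ _ _ (fun s => Phi s (tau p)) sigma); first exact:
    smooth_diff.
Qed.

Lemma lie_algebra_conj C D h : sigma @` D = C ->
  lie_algebra_of (curve_stabilizer D) h ->
  lie_algebra_of (curve_stabilizer C) (fun p => h (tau p)).
Proof.
move=> DC [[hs hc] [c [cs cG cK c0 c']]].
have ck (K : set (plane R)) : compact K -> compact (sigma @` K).
  by move=> Kc; apply: continuous_compact => //; apply: continuous_subspaceT;
    exact: smooth_continuous.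
split.
  apply: (@test_functionS _ _ (sigma @` closure [set p | h p != 0]));
    first exact: smooth_conj.
  - exact: ck.
  - by move=> p hp; exists (tau p) => //; exact: subset_closure.
exists (fun t => sigma \o c t \o tau); split.
- apply: (smooth_comp2 fin_basis_plane _ ss).
  apply: (smooth_comp2 fin_basis_Rplane (f := fun z : R * plane R =>
    (z.1, tau z.2)) _ cs).
  by apply: smooth_pair; [smth|apply: (smooth_comp2 fin_basis_plane _ ts);
    smth].
- move=> t; have [h1 h2] := cG t; split; first exact: Ham_c_conj.
  have E : tau @` (sigma @` D) = D.
    rewrite image_comp (_ : tau \o sigma = id) ?image_id //.
    by apply/funext => p /=; rewrite sK.
  by rewrite -DC -image_comp E -image_comp h2.
- move=> T; have [K Kc cKT] := cK T; exists (sigma @` K); first exact: ck.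
  move=> t p tT Kp /=; rewrite cKT ?tK // => Kt; apply: Kp; exists (tau p) =>
    //.
- by apply/funext => p /=; rewrite c0 tK.
- move=> p; rewrite -{2}(tK p) ham_vf_conj //.
  have cp : c 0 (tau p) = tau p by rewrite c0.
  have ds : differentiable sigma (c 0 (tau p)) by exact: smooth_diff.
  have := @is_derive_diff _ _ _ (fun s => c s (tau p)) sigma 0 _ ds
    (c' (tau p)).
  by rewrite /= cp.
Qed.
End Conjugation.

(** Time disappears from the hypothesis: each map of the isotopy solves the generating equations
    with its own constant k, so only single maps have to be shown to preserve C. The initial
    velocity is the field of H 0 = S. *)
Lemma lie_algebra_generating C (S : plane R -> R) : test_function S ->
  (forall phi : plane R -> plane R, forall k,
     (forall p q, phi p = q <-> p.2 = q.2 + k * 'D_ex S (p.1, q.2) /\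
       q.1 = p.1 + k * 'D_ey S (p.1, q.2)) ->
     injective phi -> (forall q, exists p, phi p = q) -> phi @` C = C) ->
  lie_algebra_of (curve_stabilizer C) S.
Proof.
move=> ST HC; split => //.
have [phi [H [k [HP H0 phiE [K Kc phiK]]]]] := generating_isotopy ST.
have [Ps [psi [_ psiK]] P0 _ _ Pf] := HP.
exists phi; split => //.
- move=> t; split; first exact: (ham_isotopy_Ham_c t HP).
  have [K1 K2] := psiK t; apply: (HC _ (k t)) => [p q||q]; first exact: phiE.
    exact: can_inj K1.
  by exists (psi t q).
- by move=> T; exists K => // t p _; exact: phiK.
- by move=> p; have := Pf 0 p; rewrite H0 P0.
Qed.

(** * Sets preserved by a generated map *)

Section Preservation.
Context (S : plane R -> R) (phi : plane R -> plane R) (k : R).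
Context (phiE : forall p q, phi p = q <->
  p.2 = q.2 + k * 'D_ex S (p.1, q.2) /\ q.1 = p.1 + k * 'D_ey S (p.1, q.2)).

Let phi_fixed p : 'D_ex S p = 0 -> 'D_ey S p = 0 -> phi p = p.
Proof. by move=> h1 h2; apply/phiE; rewrite -surjective_pairing h1 h2 mulr0
  !addr0. Qed.

Lemma generated_preserves_critical C :
  (forall p, C p -> 'D_ex S p = 0 /\ 'D_ey S p = 0) -> phi @` C = C.
Proof.
move=> CS; have fixC p : C p -> phi p = p by move=> /CS[]; exact: phi_fixed.
apply/seteqP; split=> [_ [p Cp <-]|p Cp]; first by rewrite fixC.
by exists p => //; exact: fixC.
Qed.

(** C agrees with the line at the points where S is not critical; the other points are fixed,
    whatever C is there. By injectivity a moved point cannot land on a fixed one, so a moved point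
    and its image both see C as the line. *)
Lemma generated_preserves_line C (phi_inj : injective phi) (phi_surj : forall q,
  exists p, phi p = q) :
  (forall x, 'D_ex S (x, 0) = 0) ->
  (forall p, 'D_ex S p != 0 \/ 'D_ey S p != 0 -> (C p <-> p.2 = 0)) ->
  phi @` C = C.
Proof.
move=> S0 CS.
have dich p : phi p = p \/ (C p <-> p.2 = 0).
  have [h1|h1] := eqVneq ('D_ex S p) 0; last by right; apply: CS; left.
  have [h2|h2] := eqVneq ('D_ey S p) 0; last by right; apply: CS; right.
  by left; exact: phi_fixed.
have line p q : phi p = q -> p.2 = 0 <-> q.2 = 0.
  move=> pq; have /phiE[h1 _] := pq; split=> h2; last by rewrite h1 h2 S0 mulr0
    addr0.
  have : phi p = (p.1 + k * 'D_ey S (p.1, 0), 0) by apply/phiE;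
    rewrite /= S0 h2 mulr0 addr0.
  by rewrite pq => ->.
apply/seteqP; split=> [_ [p Cp <-]|q Cq].
  have [->//|Ep] := dich p; have /(line _ _ erefl) q0 := Ep.1 Cp.
  have [fq|Eq] := dich (phi p); last exact/Eq.
  by rewrite -(phi_inj _ _ fq) in Cp.
have [p pq] := phi_surj q; exists p => //.
have [fq|Eq] := dich q; first by rewrite (phi_inj p q) // pq fq.
have /(line _ _ pq) p0 := Eq.1 Cq.
by have [fp|Ep] := dich p; [rewrite -fp pq|exact/Ep].
Qed.
End Preservation.
End LieAlgebra.

(** * Geometry of an embedded loop *)

Lemma omega_le {R : realType} (v w : plane R) : `|omega v w| <= 2 * `|w| * `|v|.
Proof.
rewrite /omega; apply: le_trans (ler_normB _ _) _.
have v1 : `|v.1| <= `|v| by rewrite [leRHS]prod_normE le_max lexx.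
have v2 : `|v.2| <= `|v| by rewrite [leRHS]prod_normE le_max lexx orbT.
have w1 : `|w.1| <= `|w| by rewrite [leRHS]prod_normE le_max lexx.
have w2 : `|w.2| <= `|w| by rewrite [leRHS]prod_normE le_max lexx orbT.
rewrite !normrM -mulrA mulr_natl mulr2n [`|w| * _]mulrC.
by apply: lerD; apply: ler_pM.
Qed.

Section Loop.
Context {R : realType} (C : set (plane R)) (c : R -> plane R) (cP :
  loop_param C c).

Let cs : smooth c. Proof. by case: cP. Qed.

Let cD s : is_derive s (1 : R) c (derive1 c s).
Proof. by rewrite derive1E; split => //; exact: smooth_derivable. Qed.

Lemma loop_periodic_int s (n : int) : c (s + n%:~R) = c s.
Proof.
have [_ cper _ _ _] := cP.
have cn (m : nat) t : c (t + m%:R) = c t.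
  by elim: m t => [|m IH] t; rewrite ?addr0 // -natr1 addrA cper.
case: n => n; first exact: cn.
have -> : (Negz n)%:~R = - n.+1%:R :> R by rewrite NegzE mulrNz.
by rewrite -[in RHS](subrK n.+1%:R s) cn.
Qed.

Lemma loop_window t0 q : C q -> exists2 s, t0 <= s < t0 + 1 & c s = q.
Proof.
have [_ _ _ _ crange] := cP; rewrite -crange => -[s _ <-].
pose n := Num.floor (s - t0).
exists (s - n%:~R).
  have := floor_itv (s - t0); rewrite -/n => /andP[h1 h2].
  by rewrite intrD in h2; apply/andP; split; lra.
by rewrite -mulrNz loop_periodic_int.
Qed.

(** Parameters with the same image have equal fractional parts, so they differ by an integer, which
    is 0 once it is smaller than 1 in absolute value. *)
Lemma loop_inj s t : `|s - t| < 1 -> c s = c t -> s = t.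
Proof.
move=> st cst; have [_ _ cinj _ _] := cP.
pose fr (x : R) := x - (Num.floor x)%:~R.
have fr01 x : 0 <= fr x < 1.
  have := floor_itv x => /andP[h1 h2].
  by rewrite intrD in h2; rewrite /fr; apply/andP; split; lra.
have cfr x : c (fr x) = c x by rewrite /fr -mulrNz loop_periodic_int.
have := cinj _ _ (fr01 s) (fr01 t); rewrite !cfr => /(_ cst).
rewrite /fr => E.
have E2 : s - t = (Num.floor s - Num.floor t)%:~R by rewrite rmorphB /=; lra.
move: st; rewrite E2 -intr_norm -[1]/(1%:~R) ltr_int => h.
have z : Num.floor s - Num.floor t = 0 by lia.
by move: E2; rewrite z => /eqP; rewrite subr_eq0 => /eqP.
Qed.

Lemma loop_compact : compact C.
Proof.
have -> : C = c @` `[0, 1].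
  apply/seteqP; split=> [q /(loop_window 0)[s /andP[s0 s1] <-]|_ [s _ <-]].
    by exists s => //=; rewrite in_itv /= s0; rewrite add0r in s1; rewrite ltW.
  by have [_ _ _ _ <-] := cP; exists s.
apply: continuous_compact; last exact: segment_compact.
by apply: continuous_subspaceT; exact: smooth_continuous.
Qed.

(* The complementary arc is compact and avoids [c s0]. *)
Lemma loop_local s0 d : 0 < d -> exists2 B, nbhs (c s0) B &
  forall q, C q -> B q -> exists2 s, `|s - s0| < d & c s = q.
Proof.
move=> d0; pose K := [set s : R | `|s - s0| <= 1 / 2 /\ d <= `|s - s0|].
have cK : compact (c @` K).
  apply: continuous_compact; first by apply: continuous_subspaceT;
    exact: smooth_continuous.
  apply: (@subclosed_compact _ _ `[s0 - 1 / 2, s0 + 1 / 2]); last 2 first.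
  - exact: segment_compact.
  - by move=> s [h _] /=; rewrite in_itv /=; move: h; rewrite ler_norml =>
      /andP[h1 h2]; apply/andP; split; lra.
  have nc : continuous (fun s : R => `|s - s0|).
    move=> s; apply: (@continuous_comp _ _ _ (fun s => s - s0) Num.norm).
      by apply: cvgB; [exact: cvg_id|exact: cvg_cst].
    exact: norm_continuous.
  have c1 : closed ((fun s : R => `|s - s0|) @^-1` [set x | x <= 1 / 2]).
    by apply: preimage_closed; [move=> s _; exact: nc|exact: closed_le].
  have c2 : closed ((fun s : R => `|s - s0|) @^-1` [set x | d <= x]).
    by apply: preimage_closed; [move=> s _; exact: nc|exact: closed_ge].
  exact: (closedI c1 c2).
have cKcl : closed (c @` K) by apply: compact_closed => //;
  exact: norm_hausdorff.
exists (~` (c @` K)).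
  apply: open_nbhs_nbhs; split; first exact: closed_openC.
  move=> [s [h1 h2] E]; have h : s = s0 by apply: loop_inj => //; lra.
  by move: h2; rewrite h subrr normr0; lra.
move=> q Cq Bq; have [s /andP[h1 h2] E] := loop_window (s0 - 1 / 2) Cq.
exists s => //; rewrite ltNge; apply/negP => h; apply: Bq; exists s => //;
  split => //.
by rewrite ler_norml; apply/andP; split; lra.
Qed.

(** By [loop_local], a point of C close to c s0 has a parameter s close to s0. The chord is then (s
    - s0) w plus a small remainder; pairing with w kills the main term, and immersion bounds |s -
    s0| by the chord. *)
Lemma loop_chord s0 e : 0 < e -> \forall q \near c s0, C q ->
  `|omega (q - c s0) (derive1 c s0)| <= e * `|q - c s0|.
Proof.
move=> e0; set w := derive1 c s0.
have w0 : 0 < `|w| by rewrite normr_gt0; exact: (param_immersion cP s0).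
have dc : differentiable c s0 by exact: smooth_diff.
(* The bound e1 <= |w| / 2 lets the main term absorb the remainder, so that |s - s0| |w| is at most
   twice the chord; with the factor 2 of [omega_le], 4 e1 <= e then suffices. *)
pose e1 := Num.min (1 / 2) (e / (4 * `|w|)) * `|w|.
have m0 : 0 < Num.min (1 / 2) (e / (4 * `|w|)).
  by rewrite lt_min divr_gt0 //= divr_gt0 // mulr_gt0.
have e10 : 0 < e1 by rewrite mulr_gt0.
have := diff_epsE dc e10.
have -> : ('d c s0 : R -> plane R) = (fun h => h *: w).
  by apply/funext => h; rewrite -[h in LHS]mulr1 [LHS]linearZ /= /w derive1E' .
move=> /nbhs_ballP[d /= d0 hd].
have [B nB BP] := loop_local s0 d0.
apply: filterS nB => q Bq Cq; have [s sd <-] := BP q Cq Bq.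
have /hd : ball (0 : R) d (s - s0) by rewrite /ball /= sub0r normrN.
rewrite subrKC => h.
set v := c s - c s0; set r := v - (s - s0) *: w.
have E : omega v w = omega r w by rewrite /omega /r /=; rewrite /GRing.scale /=;
  ring.
have rle : `|r| <= e1 * `|s - s0| by [].
have e1w : e1 <= `|w| / 2.
  have : Num.min (1 / 2) (e / (4 * `|w|)) <= 1 / 2 by rewrite ge_min lexx.
  by rewrite /e1; nra.
have e1e : 4 * e1 <= e.
  have h4 : Num.min (1 / 2) (e / (4 * `|w|)) <= e / (4 * `|w|)
    by rewrite ge_min lexx orbT.
  have : e1 <= e / (4 * `|w|) * `|w| by rewrite /e1 ler_pM2r.
  have -> : e / (4 * `|w|) * `|w| = e / 4 by field; rewrite gt_eqF.
  lra.
have vge : `|s - s0| * `|w| <= 2 * `|v|.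
  have : `|(s - s0) *: w| <= `|v| + `|r|.
    have -> : (s - s0) *: w = v - r by rewrite /r opprB addrCA subrr addr0.
    exact: ler_normB.
  rewrite normrZ; have := normr_ge0 (s - s0); nra.
rewrite E; apply: le_trans (omega_le r w) _.
have := normr_ge0 (s - s0); have := normr_ge0 v; nra.
Qed.

(** Chords of gam are chords of C, hence almost omega-orthogonal to the tangent, while to first
    order they equal t v; dividing by t leaves an arbitrarily small bound. *)
Lemma loop_tangent s0 (gam : R -> plane R) (v : plane R) :
  gam 0 = c s0 -> (forall t, C (gam t)) -> is_derive (0 : R) (1 : R) gam v ->
  omega v (derive1 c s0) = 0.
Proof.
move=> g0 gC [/derivable1_diffP dg dv].
apply/eqP; rewrite -normr_le0; apply/ler_addgt0Pr => e e0; rewrite add0r.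
set w := derive1 c s0.
have v0 : 0 < `|v| + 1 by rewrite ltr_pwDr.
have w0 : 0 < 4 * (`|w| + 1) by rewrite mulr_gt0 // ltr_pwDr.
(* The chord accounts for e1 (|v| + 1) = e / 2 and the remainder for 2 |w| eta <= e / 2; eta <= 1
   bounds the chord by (|v| + 1) |t|. *)
pose e1 := e / (2 * (`|v| + 1)); pose eta := Num.min 1 (e / (4 * (`|w| + 1))).
have e10 : 0 < e1 by rewrite divr_gt0 // mulr_gt0.
have eta0 : 0 < eta by rewrite lt_min ltr01 divr_gt0.
have eta1 : eta <= 1 by rewrite /eta ge_min lexx.
have etae : eta * (4 * (`|w| + 1)) <= e.
  by rewrite -ler_pdivlMr // /eta ge_min lexx orbT.
have e1e : e1 * (2 * (`|v| + 1)) = e by rewrite /e1 divfK // gt_eqF // mulr_gt0.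
have n1 : \forall t \near (0 : R), `|gam t - gam 0 - t *: v| <= eta * `|t|.
  have := diff_epsE dg eta0; apply: filterS => t; rewrite add0r.
  by rewrite -[t in 'd _ _ t]mulr1 [X in _ - X]linearZ /= -deriveE // dv.
have n2 : \forall t \near (0 : R), `|omega (gam t - gam 0) w| <= e1 * `|gam t -
  gam 0|.
  have gc : {for 0, continuous gam} by exact: differentiable_continuous.
  have n0 := loop_chord s0 e10; rewrite -g0 in n0.
  have n0' : \forall t \near (0 : R), C (gam t) ->
    `|omega (gam t - gam 0) w| <= e1 * `|gam t - gam 0| by exact: gc n0.
  by apply: filterS n0' => t; exact.
have /nbhs_ballP[r0 /= r00 hr] : \forall t \near (0 : R),
    `|gam t - gam 0 - t *: v| <= eta * `|t| /\
    `|omega (gam t - gam 0) w| <= e1 * `|gam t - gam 0|.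
  by near=> t; split; near: t.
pose t := r0 / 2.
have [h1 h2] : `|gam t - gam 0 - t *: v| <= eta * `|t| /\
    `|omega (gam t - gam 0) w| <= e1 * `|gam t - gam 0|.
  apply: hr; rewrite -ball_normE /= sub0r normrN gtr0_norm /t ?divr_gt0 //; lra.
have t0 : t != 0 by rewrite gt_eqF // divr_gt0.
have tp : 0 < `|t| by rewrite normr_gt0.
set q := gam t - gam 0 in h1 h2; set r := q - t *: v in h1.
have E : t * omega v w = omega q w - omega r w by rewrite /omega /r /=
  /GRing.scale /=; ring.
have qle : `|q| <= (`|v| + 1) * `|t|.
  have -> : q = t *: v + r by rewrite /r addrC subrK.
  apply: le_trans (ler_normD _ _) _; rewrite normrZ mulrDl mul1r mulrC lerD2l.
  by apply: le_trans h1 _; rewrite ler_piMl.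
have h3 : `|t| * `|omega v w| <= e1 * ((`|v| + 1) * `|t|) +
  2 * `|w| * (eta * `|t|).
  rewrite -normrM E; apply: le_trans (ler_normB _ _) _; apply: lerD.
    by apply: le_trans h2 _; rewrite ler_pM2l.
  by apply: le_trans (omega_le r w) _; rewrite ler_wpM2l // mulr_ge0.
have h4 : e1 * ((`|v| + 1) * `|t|) = `|t| * (e / 2) by rewrite -e1e; field.
have h5 : 2 * `|w| * (eta * `|t|) <= `|t| * (e / 2).
  have -> : 2 * `|w| * (eta * `|t|) = `|t| * (2 * `|w| * eta) by ring.
  by rewrite ler_pM2l //; lra.
rewrite -(ler_pM2l tp); apply: le_trans h3 _; rewrite h4.
by apply: le_trans (lerD (lexx _) h5) _; rewrite -mulrDr -splitr.
Unshelve. all: by end_near. Qed.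

(** Tangency of the field of h to C says that its omega-pairing with c' is 0, and this pairing is
    the derivative of h along c. *)
Lemma lie_algebra_constant h p q :
  lie_algebra_of (curve_stabilizer C) h -> C p -> C q -> h p = h q.
Proof.
move=> [[hs _] [f [fs fG _ f0 f']]] Cp Cq.
have fC t s : C (f t (c s)).
  have [_ fCt] := fG t; have [_ _ _ _ cr] := cP.
  by rewrite -{1}fCt; exists (c s) => //; rewrite -cr; exists s.
have d s : is_derive s (1 : R) (fun s => h (c s)) 0.
  have dh : differentiable h (c s) by exact: smooth_diff.
  have := is_derive_diff dh (cD s).
  rewrite -omega_ham_vf // (@loop_tangent s (fun t => f t (c s))) //;
    last by rewrite f0.
have [_ _ _ _ cr] := cP.
move: Cp Cq; rewrite -{1 2}cr => -[s _ <-] [t _ <-].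
exact: (is_derive_0_is_cst s t d).
Qed.
End Loop.

(** * Symplectic charts of the whole plane straightening an arc of C *)

Section Chart.
Context {R : realType}.

Lemma is_derive_fst (p v : plane R) : is_derive p v (fun r : plane R => r.1)
  v.1.
Proof. by split; [apply: smooth_derivable; smth|exact: derive_fst]. Qed.

Lemma is_derive_snd (p v : plane R) : is_derive p v (fun r : plane R => r.2)
  v.2.
Proof. by split; [apply: smooth_derivable; smth|exact: derive_snd]. Qed.

Lemma is_derive_comp_fst (g : R -> R) (p v : plane R) : smooth g ->
  is_derive p v (fun r => g r.1) (v.1 * 'D_1 g p.1).
Proof.
move=> gs; split.
  by apply: smooth_derivable; apply: (smooth_comp fin_basisR _ gs); smth.
have dg : differentiable g p.1 by exact: smooth_diff.
have df : differentiable (fun r : plane R => r.1) p by apply: smooth_diff; smth.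
have dgf : differentiable (fun r : plane R => g r.1) p.
  by apply: smooth_diff; apply: (smooth_comp fin_basisR _ gs); smth.
rewrite deriveE // (diff_compE v df dg) -(deriveE _ df) derive_fst.
by rewrite -[X in 'd _ _ X]mulr1 [LHS]linearZ /= -(deriveE _ dg).
Qed.

(** Rescaling the fixed function x bump(x) leaves its derivative bounded by the same M for every d;
    hence d may be chosen after M. *)
Lemma smooth_clamp : exists2 M : R, 0 < M & forall s0 d : R, 0 < d ->
  exists z : R -> R, [/\ smooth z, forall s, `|s - s0| <= d -> z s = s,
    forall s, `|z s - s0| <= 2 * d & forall s, `|'D_1 z s| <= M].
Proof.
pose z1 (x : R) := x * bump x.
have z1s : smooth z1 by apply: smoothM; [smth|exact: smooth_bump].
have z1_0 x : 2 <= `|x| -> z1 x = 0 by move=> x2; rewrite /z1 bump0 // mulr0.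
have z1'c : continuous ('D_1 z1) by apply: smooth_continuous;
  exact: smooth_derive.
have bnd (f : R -> R) : continuous f -> (forall x, 2 < `|x| -> f x = 0) ->
    exists2 M : R, 0 < M & forall x, `|f x| <= M.
  move=> fc f0.
  have /compact_bounded[M [_ HM]] : compact (f @` `[(- 2 : R), 2]).
    by apply: continuous_compact; [exact: continuous_subspaceT|exact:
      segment_compact].
  exists (`|M| + 1); first by rewrite ltr_pwDr.
  move=> x; have [x2|x2] := ltP 2 `|x|; first by rewrite f0 // normr0 addr_ge0.
  apply: HM; first by rewrite (le_lt_trans (ler_norm M)) // ltrDl.
  by exists x => //=; rewrite in_itv /= -ler_norml.
have [M M0 HM] : exists2 M : R, 0 < M & forall x, `|'D_1 z1 x| <= M.
  apply: bnd => // x x2; apply: derive_cst_near.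
  have nc : {for x, continuous (fun y : R => `|y|)} by exact: norm_continuous.
  have : \forall y \near x, 2 < `|y| by exact: nc (lt_nbhsr x2).
  by apply: filterS => y y2; rewrite !z1_0 // ltW.
exists M => // s0 d d0.
exists (fun s => s0 + d * z1 (d^-1 * (s - s0))).
have ls : smooth (fun s => d^-1 * (s - s0)) by smth.
have zs : smooth (fun s => z1 (d^-1 * (s - s0))) by exact:
  (smooth_comp fin_basisR ls z1s).
split.
- by smth.
- move=> s sd; rewrite /z1 bump1 ?mulr1; last first.
    by rewrite normrM normfV (gtr0_norm d0) mulrC ler_pdivrMr // mul1r.
  by rewrite mulVKf ?gt_eqF // addrC subrK.
- move=> s; rewrite [s0 + _]addrC addrK normrM gtr0_norm // mulrC ler_pM2r //.
  set x := d^-1 * _; have [x2|x2] := leP 2 `|x|;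
    first by rewrite z1_0 // normr0.
  rewrite normrM -[leRHS]mulr1; apply: ler_pM => //; first exact: ltW.
  rewrite ger0_norm ?bump_ge0 // /bump -[leRHS]mulr1.
  by apply: ler_pM; rewrite ?step_ge0 ?step_le1.
- move=> s.
  have d1 : is_derive s (1 : R) (fun s : R => d^-1 * (s - s0)) d^-1.
    have d2 : is_derive s (1 : R) (fun s : R => s - s0) 1.
      by have := is_deriveB (is_derive_id s (1 : R))
        (is_derive_cst s0 s (1 : R)); rewrite subr0.
    by have := is_deriveZ d^-1 d2; rewrite [_ *: 1]mulr1.
  have d3 : is_derive (d^-1 * (s - s0)) (1 : R) z1 ('D_1 z1 (d^-1 * (s - s0))).
    by split => //; exact: smooth_derivable.
  have d4 := is_deriveZ d (@is_derive_reparam _ _ z1 (fun s => d^-1 * (s - s0))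
    s _ _ d3 d1).
  have d5 := is_deriveD (is_derive_cst s0 s (1 : R)) d4.
  have -> : 'D_1 (fun s => s0 + d * z1 (d^-1 * (s - s0))) s =
    'D_1 z1 (d^-1 * (s - s0)).
    case: d5 => _; rewrite add0r scalerA mulfV ?gt_eqF // scale1r; exact.
  exact: HM.
Qed.

(* With [z] a clamp, [s |-> u (z s) + s - z s] is a global diffeomorphism of the
   line that extends [u] near [s0]. *)
Lemma local_inverse (u : R -> R) s0 : smooth u -> 'D_1 u s0 = 1 ->
  exists (V : R -> R) (d : R), [/\ smooth V, 0 < d, V (u s0) = s0,
    forall s, `|s - s0| <= d -> V (u s) = s &
    forall a, `|V a - s0| <= d -> u (V a) = a].
Proof.
move=> us u1; have [M M0 HM] := smooth_clamp.
have u'c : continuous ('D_1 u) by apply: smooth_continuous;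
  exact: smooth_derive.
(* As |z'| <= M, this tolerance on u' - 1 keeps the derivative 1 + z' (u' - 1) of the extension at
   least 1/2. *)
have e0 : 0 < (2 * M)^-1 by rewrite invr_gt0 mulr_gt0.
have [d d0 Hd] : exists2 d, 0 < d & forall s, `|s - s0| <= 2 * d ->
  `|'D_1 u s - 1| <= (2 * M)^-1.
  have /cvgrPdist_le/(_ _ e0)/nbhs_ballP[r /= r0 hr] := u'c s0.
  exists (r / 3); first by rewrite divr_gt0.
  move=> s sr; have bs : ball s0 r s by rewrite -ball_normE /=
    distrC (le_lt_trans sr) //; lra.
  by have := hr s bs; rewrite u1 distrC.
have [z [zs z1 z2 z']] := HM s0 d d0.
pose U s := u (z s) + (s - z s).
have uzs : smooth (fun s => u (z s)) by exact: (smooth_comp fin_basisR zs us).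
have Us : smooth U by rewrite /U; smth.
have U' s : is_derive s (1 : R) U (1 + 'D_1 z s * ('D_1 u (z s) - 1)).
  have dz : is_derive s (1 : R) z ('D_1 z s) by split => //;
    exact: smooth_derivable.
  have du : is_derive (z s) (1 : R) u ('D_1 u (z s)) by split => //;
    exact: smooth_derivable.
  have d1 := is_deriveD (is_derive_reparam du dz)
    (is_deriveB (is_derive_id s (1 : R)) dz).
  by apply: (is_derive_eq d1); rewrite /GRing.scale /=; ring.
(* The inverse in one variable is the implicit function of a family constant in its parameter. *)
pose F (q : R * R) := U q.2.
have Fs : smooth F by apply: (smooth_comp fin_basisR _ Us); smth.
have F' q : 1 / 2 <= 'D_(0, 1) F q.
  have -> : 'D_(0, 1) F q = 'D_1 U q.2.
    have dU : differentiable U q.2 by exact: smooth_diff.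
    have df : differentiable (fun r : R * R => r.2) q by apply: smooth_diff;
      smth.
    have dF : differentiable F q by exact: smooth_diff.
    by rewrite deriveE // (diff_compE _ df dU) -(deriveE _ df) derive_snd /=
      -(deriveE _ dU).
  have -> : 'D_1 U q.2 = 1 + 'D_1 z q.2 * ('D_1 u (z q.2) - 1) by case:
    (U' q.2).
  have : `|'D_1 z q.2 * ('D_1 u (z q.2) - 1)| <= M * (2 * M)^-1.
    by rewrite normrM; apply: ler_pM => //; exact: Hd.
  have -> : M * (2 * M)^-1 = 1 / 2 by field; rewrite gt_eqF.
  by rewrite ler_norml => /andP[h _]; lra.
have [G [Gs GE GK]] := implicit_function fin_basisR Fs F'.
have Uu s : `|s - s0| <= d -> U s = u s by move=> /z1 E;
  rewrite /U E subrr addr0.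
have s00 : `|s0 - s0| <= d by rewrite subrr normr0 ltW.
exists (fun a => G (0, a)), d; split => //.
- have bRR : fin_basis (R * R)%type by apply: fin_basis_prod; exact: fin_basisR.
  by apply: (smooth_comp bRR _ Gs); smth.
- by rewrite -Uu // GK.
- by move=> s sd; rewrite -Uu // GK.
- by move=> a ad; rewrite -Uu // -[RHS](GE 0 a).
Qed.

(** In a frame (e, f) with e tangent to C and omega e f = 1, the arc is the graph of a function g of
    the abscissa. The shear adding g to the ordinate preserves area, is defined on the whole plane
    and has an explicit inverse. *)
Lemma loop_chart (C : set (plane R)) (c : R -> plane R) s0 : loop_param C c ->
  exists (sigma tau : plane R -> plane R) (B : set (plane R)),
  [/\ smooth sigma /\ smooth tau, cancel sigma tau /\ cancel tau sigma,
      forall q v w, omega ('d sigma q v) ('d sigma q w) = omega v w,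
      nbhs (c s0) B & forall q, B q -> (C q <-> (tau q).2 = 0)].
Proof.
move=> cP; have cs : smooth c by case: cP.
pose e := derive1 c s0; pose n := e.1 ^+ 2 + e.2 ^+ 2.
have n0 : n != 0.
  apply/eqP => /eqP; rewrite paddr_eq0 ?sqr_ge0 // !sqrf_eq0 =>
    /andP[/eqP h1 /eqP h2].
  have /eqP := param_immersion cP s0; apply.
  by rewrite -/e [LHS]surjective_pairing h1 h2.
(* The vector e turned by a right angle and divided by its squared Euclidean length, so that omega e
   f = 1. *)
pose f : plane R := (- e.2 / n, e.1 / n).
have ef : omega e f = 1 by rewrite /omega /f /= /n; field.
have dec q : q = (omega q f * e.1 + omega e q * f.1, omega q f * e.2 +
  omega e q * f.2).
  rewrite [LHS]surjective_pairing; congr pair.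
    by rewrite -[LHS]mulr1 -ef /omega; ring.
  by rewrite -[LHS]mulr1 -ef /omega; ring.
have s_omega1 : smooth (fun q : plane R => omega q f) by rewrite /omega; smth.
have s_omega2 : smooth (fun q : plane R => omega e q) by rewrite /omega; smth.
pose u s := omega (c s) f; pose v s := omega e (c s).
have us : smooth u by exact: (smooth_comp fin_basis_plane cs s_omega1).
have vs : smooth v by exact: (smooth_comp fin_basis_plane cs s_omega2).
have u1 : 'D_1 u s0 = 1.
  have dc : differentiable c s0 by exact: smooth_diff.
  have dom : differentiable (fun q : plane R => omega q f) (c s0) by exact:
    smooth_diff.
  have du : differentiable u s0 by exact: smooth_diff.
  rewrite (deriveE _ du) (diff_compE _ dc dom) -(deriveE _ dom) -(deriveE _ dc)
    -derive1E -/e.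
  transitivity (omega e f) => //.
  by apply: derive_affine => s; rewrite /omega /= /GRing.scale /=; ring.
have [V [d [Vs d0 V0 Vu uV]]] := local_inverse us u1.
pose g a := v (V a).
have gs : smooth g by exact: (smooth_comp fin_basisR Vs vs).
pose sigma (r : plane R) : plane R := (r.1 * e.1 + (r.2 + g r.1) * f.1,
  r.1 * e.2 + (r.2 + g r.1) * f.2).
pose tau (q : plane R) : plane R := (omega q f, omega e q - g (omega q f)).
have sigma_f r : omega (sigma r) f = r.1.
  by rewrite -[RHS]mulr1 -ef /sigma /omega /=; ring.
have sigma_e r : omega e (sigma r) = r.2 + g r.1.
  by rewrite -[RHS]mulr1 -ef /sigma /omega /=; ring.
(* On the first set u (V a) = a at the abscissa a of q, so a zero second coordinate puts q on C. On
   the second, a point of C has a parameter s with V (u s) = s, so its second coordinate is 0. *)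
exists sigma, tau; exists ([set q | `|V (omega q f) - s0| < d] `&`
  [set q | C q -> exists2 s, `|s - s0| < d & c s = q]).
split.
- have g1 : smooth (fun r : plane R => g r.1) by apply:
    (smooth_comp fin_basisR _ gs); smth.
  have g2 : smooth (fun r : plane R => g (omega r f)) by exact:
    (smooth_comp fin_basisR s_omega1 gs).
  by rewrite /sigma /tau; split; smth.
- split=> q; first by rewrite /tau sigma_f sigma_e addrK -surjective_pairing.
  by rewrite [RHS]dec /sigma /tau /= subrK.
- move=> q a b.
  have ds w : 'd sigma q w = (w.1 * e.1 + (w.2 + w.1 * 'D_1 g q.1) * f.1,
      w.1 * e.2 + (w.2 + w.1 * 'D_1 g q.1) * f.2).
    have dk (k l : R) : is_derive q w (fun r : plane R => r.1 * k +
      (r.2 + g r.1) * l)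
        (w.1 * k + (w.2 + w.1 * 'D_1 g q.1) * l).
      have h1 := is_deriveM (is_derive_fst q w) (is_derive_cst k q w).
      have h2 := is_deriveD (is_derive_snd q w) (is_derive_comp_fst q w gs).
      have h3 := is_deriveD h1 (is_deriveM h2 (is_derive_cst l q w)).
      by apply: (is_derive_eq h3); rewrite /GRing.scale /=; ring.
    have sk (k l : R) : smooth (fun r : plane R => r.1 * k + (r.2 + g r.1) * l).
      have g1 : smooth (fun r : plane R => g r.1) by apply:
        (smooth_comp fin_basisR _ gs); smth.
      by smth.
    have d1 : differentiable (fun r : plane R => r.1 * e.1 + (r.2 + g r.1) *
      f.1) q by exact: smooth_diff.
    have d2 : differentiable (fun r : plane R => r.1 * e.2 + (r.2 + g r.1) *
      f.2) q by exact: smooth_diff.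
    rewrite /sigma (diff_pair d1 d2) /= -(deriveE _ d1) -(deriveE _ d2).
    by case: (dk e.1 f.1) => _ ->; case: (dk e.2 f.2) => _ ->.
  rewrite !ds -[RHS]mulr1 -ef /omega /=; ring.
- apply: filterI.
    have Vc : {for c s0, continuous (fun q : plane R => V (omega q f))}.
      by apply: smooth_continuous; exact: (smooth_comp fin_basisR s_omega1 Vs).
    move/cvgrPdist_lt : Vc => /(_ _ d0); apply: filterS => q /=.
    by rewrite -/(u s0) V0 distrC.
  have [B nB BP] := loop_local cP s0 d0.
  by apply: filterS nB => q Bq Cq; exact: BP.
- move=> q [qV qC]; split=> [/qC[s sd <-]|]; rewrite /tau /=.
    by rewrite /g -/(u s) Vu ?subrr // ltW.
  move=> /eqP; rewrite subr_eq0 => /eqP h.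
  have [_ _ _ _ <-] := cP; exists (V (omega q f)) => //.
  rewrite [LHS]dec [RHS]dec -/(u (V (omega q f))) uV ?(ltW qV) //.
  by rewrite h.
Qed.
End Chart.

(** * The Lie algebra of the stabilizer *)

Section StabilizerLieAlgebra.
Context {R : realType} (C : set (plane R)) (c : R -> plane R) (cP :
  loop_param C c).
Implicit Types (h b : plane R -> R).

Let L := lie_algebra_of (curve_stabilizer C).

Lemma lie_algebra_critical h : test_function h ->
  (forall p, C p -> 'D_ex h p = 0 /\ 'D_ey h p = 0) -> L h.
Proof.
move=> hT hC; apply: lie_algebra_generating => // phi k phiE _ _.
exact: (generated_preserves_critical phiE).
Qed.

Lemma test_functionM b h : smooth b -> test_function h ->
  test_function (fun p => b p * h p).
Proof.
move=> bs [hs hc]; apply: (@test_functionS _ _ _ _ hc); first exact: smoothM.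
move=> p; rewrite mulf_eq0 negb_or => /andP[_ hp]; exact: subset_closure.
Qed.

(** Off C, a cutoff supported away from C makes b h critical along C. At a point of C, b h is read
    in a chart, generates an isotopy there and is conjugated back. The cutoff is chosen before h, so
    that it can be applied to successive remainders. *)
Lemma lie_algebra_local (p : plane R) : exists b,
  [/\ smooth b, \forall q \near p, b q = 1 &
  forall h, test_function h -> (forall q, C q -> h q = 0) ->
    L (fun q => b q * h q)].
Proof.
have [Cp|nCp] := pselect (C p); last first.
  have Ccl : closed C by apply: compact_closed;
    [exact: norm_hausdorff|exact: (loop_compact cP)].
  have nC : nbhs p (~` C) by apply: open_nbhs_nbhs; split => //;
    exact: closed_openC.
  have [r r0 rC] := box_sub_nbhs nC.
  have r20 : 0 < r / 2 by rewrite divr_gt0.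
  exists (bump2 p (r / 2)); split; first exact: smooth_bump2.
    apply/nbhs_ballP; exists (r / 2) => //= q; rewrite -ball_normE /= distrC =>
      /ltW.
    exact: bump2_1.
  move=> h hT _; apply: lie_algebra_critical; first exact:
    test_functionM (smooth_bump2 _ _) hT.
  have H q : bump2 p (r / 2) q * h q != 0 -> box p r q.
    rewrite mulf_eq0 negb_or => /andP[bq _].
    by have := bump2_0 r20 bq; rewrite mulrC divfK.
  move=> q Cq; split; apply/eqP; apply: contraPT Cq;
    move=> /(derive_neq0_compact (@compact_box _ p r) H); exact: rC.
have [_ _ _ _ cr] := cP; move: (Cp); rewrite -{1}cr => -[s0 _ Ep]; rewrite -Ep.
have [sigma [tau [B [[ss ts] [sK tK] symp nB BC]]]] := loop_chart s0 cP.
have [r r0 rB] := box_sub_nbhs nB.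
have r20 : 0 < r / 2 by rewrite divr_gt0.
set b := bump2 (c s0) (r / 2).
have bs : smooth b by exact: smooth_bump2.
exists b; split => //.
  apply/nbhs_ballP; exists (r / 2) => //= q; rewrite -ball_normE /= distrC =>
    /ltW.
  exact: bump2_1.
move=> h [hs hc] hC.
have bB q : b q != 0 -> box (c s0) r q.
  by move=> bq; have := bump2_0 r20 bq; rewrite mulrC divfK.
pose S q := b (sigma q) * h (sigma q).
pose K := tau @` box (c s0) r.
have Kc : compact K.
  apply: continuous_compact; last exact: compact_box.
  by apply: continuous_subspaceT; exact: smooth_continuous.
have SK q : S q != 0 -> K q.
  rewrite mulf_eq0 negb_or => /andP[bq _].
  by exists (sigma q); [exact: bB|rewrite sK].
have Ss : smooth S.
  have bhs : smooth (fun q => b q * h q) by exact: smoothM.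
  exact: (smooth_comp fin_basis_plane ss bhs).
have ST : test_function S by exact: test_functionS Kc SK.
have S0 q : q.2 = 0 -> S q = 0.
  move=> q0; have [E|bq] := eqVneq (b (sigma q)) 0; first by rewrite /S E mul0r.
  rewrite /S hC ?mulr0 //; apply/(BC _ (rB _ (bB _ bq))); by rewrite sK.
(* All of C seen in the chart. It coincides with the line y = 0 on K, and S vanishes outside K. *)
pose D : set (plane R) := [set q | C (sigma q)].
have DC : sigma @` D = C.
  apply/seteqP; split=> [_ [q Dq <-] //|q Cq].
  by exists (tau q); rewrite /D /= tK.
have LS : lie_algebra_of (curve_stabilizer D) S.
  apply: lie_algebra_generating => // phi k phiE phi_inj phi_surj.
  apply: (generated_preserves_line phiE) => //.
    move=> x; apply: derive_affine => s; rewrite scaler0 addr0 !S0 //=.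
    by rewrite [s *: 0]scaler0 addr0.
  move=> q Sq; have [p' p'B <-] : K q.
    by case: Sq; exact: derive_neq0_compact.
  by rewrite /D /= tK; exact: BC (rB _ p'B).
have := lie_algebra_conj ss ts sK tK symp DC LS.
by rewrite (_ : (fun p => S (tau p)) = (fun q => b q * h q)) //; apply/funext =>
  q; rewrite /S tK.
Qed.

Let LD g h : L g -> L h -> L (fun p => g p + h p).
Proof.
apply: lie_algebra_add => phi psi;
  exact: (subgroup_comp (stabilizer_subgroup C)).
Qed.

(** The cutoffs of a finite cover are peeled off one at a time: in h = b h + (1 - b) h the remainder
    vanishes wherever b = 1, so the rest of the list still covers its nonzero points. *)
Lemma lie_algebra_vanishing h : test_function h ->
  (forall q, C q -> h q = 0) -> L h.
Proof.
move=> hT0 hC0.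
have [bb bbP] := choice (fun p => lie_algebra_local p).
have cov : forall l : seq (plane R), forall h, test_function h ->
    (forall q, C q -> h q = 0) ->
    (forall q, h q != 0 -> exists2 p, p \in l & bb p q = 1) -> L h.
  elim=> [|p l IH] {hT0 hC0}h hT hC hl.
    have -> : h = fun=> 0.
      by apply/funext => q; apply/eqP/negP => /negP /hl[p].
    by apply: lie_algebra_zero; case: (stabilizer_subgroup C).
  have [bs _ bL] := bbP p.
  have -> : h = (fun q => bb p q * h q + (1 - bb p q) * h q).
    by apply/funext => q; rewrite -mulrDl subrKC mul1r.
  apply: LD; first exact: bL.
  apply: IH.
  - by apply: test_functionM => //; smth.
  - by move=> q Cq; rewrite hC // mulr0.
  - move=> q; rewrite mulf_eq0 negb_or => /andP[b1 hq].
    have [p' p'l E] := hl q hq; exists p' => //.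
    move: p'l E; rewrite in_cons => /predU1P[-> E|//].
    by rewrite E subrr eqxx in b1.
have [hs hc] := hT0.
move: (hc); rewrite compact_cover.
move=> /(_ (plane R) setT (fun p => ((fun q => bb p q = 1) : set (plane R))°)).
case=> [p _|q _|D _ Dcov]; first exact: open_interior.
- by exists q => //; have [_ nb _] := bbP q.
- apply: (cov (finmap.enum_fset D)) => // q hq.
  have hq' : closure [set p | h p != 0] q by exact: subset_closure.
  have [p pD pq] := Dcov q hq'.
  by exists p => //; exact: (@interior_subset _ _ q pq).
Qed.

(** The constant is carried by a eta, with eta = 1 near C, which is critical along C; the difference
    h - a eta vanishes on C. *)
Lemma lie_algebra_of_constant h a : test_function h ->
  (forall q, C q -> h q = a) -> L h.
Proof.
move=> hT ha; have [hs hc] := hT.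
have [M M0 CM] := compact_box_cover (loop_compact cP).
have M10 : 0 < M + 1 by rewrite addr_gt0.
(* The margin 1 around a box containing C makes eta equal to 1 on a neighbourhood of C, as vanishing
   derivatives require. *)
pose eta := bump2 (0 : plane R) (M + 1).
have es : smooth eta by exact: smooth_bump2.
have eT (k : R) : test_function (fun q => k * eta q).
  apply: (@test_functionS _ _ (box 0 (2 * (M + 1)))); [|exact: compact_box|].
    by apply: smoothM => //; exact: smooth_cst.
  by move=> q; rewrite mulf_eq0 negb_or => /andP[_]; exact: bump2_0.
have e1 q : C q -> \forall q' \near q, eta q' = 1.
  move=> /CM /boxP; rewrite subr0 => qM; apply/nbhs_ballP; exists 1 => //= q'.
  rewrite -ball_normE /= distrC => q'q; apply: bump2_1 => //; rewrite subr0.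
  by rewrite -(subrK q q') (le_trans (ler_normD _ _)) // addrC lerD // ltW.
have -> : h = (fun q => a * eta q + (h q - a * eta q)) by apply/funext => q;
  rewrite subrKC.
apply: LD.
  apply: lie_algebra_critical => // q Cq; have := e1 q Cq => nq.
  have E : \forall q' \near q, a * eta q' = a * eta q.
    by apply: filterS nq => q' ->; rewrite (nbhs_singleton (e1 q Cq)).
  by split; exact: derive_cst_near.
apply: lie_algebra_vanishing => [|q Cq]; last first.
  by rewrite ha // (nbhs_singleton (e1 q Cq)) mulr1 subrr.
have [_ ec] := eT a.
apply: (@test_functionS _ _ (closure [set p | h p != 0] `|` closure
  [set p | a * eta p != 0])).
- by apply: smoothB => //; case: (eT a).
- exact: compactU.
- move=> p; have [->|hp] := eqVneq (h p) 0; last by move=> _; left;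
    exact: subset_closure.
  by rewrite sub0r oppr_eq0 => ep; right; exact: subset_closure.
Qed.

Lemma stabilizer_lie_algebraP h :
  L h <-> test_function h /\ forall p q, C p -> C q -> h p = h q.
Proof.
split=> [Lh|[hT hC]].
  split; first by case: Lh.
  by move=> p q; exact: (lie_algebra_constant cP).
have [_ _ _ _ cr] := cP.
have C0 : C (c 0) by rewrite -cr; exists 0.
by apply: (lie_algebra_of_constant (a := h (c 0))) => // q Cq; exact: hC.
Qed.

Lemma constant_derive h s : smooth h -> (forall p q, C p -> C q -> h p = h q) ->
  'd h (c s) (derive1 c s) = 0.
Proof.
move=> hs hC; have [cs _ _ _ cr] := cP.
have dc : differentiable c s by exact: smooth_diff.
have dh : differentiable h (c s) by exact: smooth_diff.
have dhc : differentiable (fun s => h (c s)) s by exact: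
  (differentiable_comp dc dh).
rewrite derive1E (deriveE _ dc) -(diff_compE _ dc dh) -(deriveE _ dhc).
apply: derive_affine => t; rewrite scaler0 addr0; apply: hC; by rewrite -cr;
  eexists.
Qed.

(** Both fields are omega-orthogonal to the nonzero tangent w, and the planar identity omega(u, v) w
    = omega(u, w) v - omega(v, w) u then forces omega(u, v) = 0. *)
Lemma bracket_constant g h p : smooth g -> smooth h ->
  (forall p q, C p -> C q -> g p = g q) -> (forall p q, C p -> C q ->
    h p = h q) ->
  C p -> bracket g h p = 0.
Proof.
move=> gs hs gC hC; have [_ _ _ imm cr] := cP; rewrite -{1}cr => -[s _ <-].
have dg : differentiable g (c s) by exact: smooth_diff.
have dh : differentiable h (c s) by exact: smooth_diff.
have := constant_derive s gs gC; have := constant_derive s hs hC.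
rewrite -!omega_ham_vf // /bracket.
set w := derive1 c s; set u := ham_vf g _; set v := ham_vf h _ => h1 h2.
have : omega u v * w.1 = 0.
  have -> : omega u v * w.1 = v.1 * omega u w + u.1 * - omega v w
    by rewrite /omega; ring.
  by rewrite h1 h2 oppr0 !mulr0 addr0.
have : omega u v * w.2 = 0.
  have -> : omega u v * w.2 = v.2 * omega u w + u.2 * - omega v w
    by rewrite /omega; ring.
  by rewrite h1 h2 oppr0 !mulr0 addr0.
move=> /eqP; rewrite mulf_eq0 => /orP[/eqP//|/eqP w2] /eqP; rewrite mulf_eq0 =>
  /orP[/eqP//|/eqP w1].
by have /eqP := imm s; case; rewrite -/w [LHS]surjective_pairing w1 w2.
Qed.

Lemma smooth_bracket g h : smooth g -> smooth h -> smooth (bracket g h).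
Proof.
move=> gs hs; have -> : bracket g h =
  (fun p => 'D_ey g p * - 'D_ex h p - (- 'D_ex g p) * 'D_ey h p) by [].
by smth.
Qed.

Lemma stabilizer_lie_subalgebra : lie_subalgebra L.
Proof.
split.
- by move=> h [].
- by apply: lie_algebra_zero; case: (stabilizer_subgroup C).
- move=> a g h /stabilizer_lie_algebraP[[gs gc] gC]
    /stabilizer_lie_algebraP[[hs hc] hC].
  apply/stabilizer_lie_algebraP; split; last by move=> p q Cp Cq;
    rewrite (gC p q) // (hC p q).
  apply: (@test_functionS _ _ (closure [set p | g p != 0] `|` closure
    [set p | h p != 0])).
  - by apply: smoothD => //; apply: smoothM => //; exact: smooth_cst.
  - exact: compactU.
  - move=> p; have [->|gp] := eqVneq (g p) 0; last by move=> _; left;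
      exact: subset_closure.
    by rewrite mulr0 add0r => hp; right; exact: subset_closure.
- move=> g h /stabilizer_lie_algebraP[[gs gc] gC]
    /stabilizer_lie_algebraP[[hs hc] hC].
  apply/stabilizer_lie_algebraP; split; last first.
    by move=> p q Cp Cq; rewrite !bracket_constant.
  apply: (@test_functionS _ _ (closure [set p | g p != 0])) => //; first exact:
    smooth_bracket.
  move=> p; apply: contra_neqP => Kp; rewrite /bracket /ham_vf.
  have E v : 'D_v g p = 0 by apply/eqP; apply: contra_notT Kp;
    exact: derive_neq0_closure.
  by rewrite !E oppr0 /omega !mul0r subrr.
Qed.
End StabilizerLieAlgebra.

(** * Maximality *)

Section Maximality.
Context {R : realType}.

(** A positive value w t would persist as w >= w t / 2 on an interval of positive length and bound
    the integral from below. *)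
Lemma Rintegral01_eq0 (w : R -> R) : continuous w -> (forall t, 0 <= w t) ->
  \int[lebesgue_measure]_(t in `[0, 1]) w t = 0 -> forall t, 0 <= t <= 1 ->
    w t = 0.
Proof.
move=> wc w0 I0 t /andP[t0 t1]; apply/eqP; rewrite eq_le w0 andbT leNgt;
  apply/negP => wt.
have wi : (@lebesgue_measure R).-integrable `[0, 1] (EFin \o w).
  apply: continuous_compact_integrable; first exact: segment_compact.
  exact: continuous_subspaceT.
have EI : (\int[lebesgue_measure]_(x in `[0%R, 1%R]) (w x)%:E = 0)%E.
  by rewrite -(fineK (integrable_fin_num _ wi)) //; congr EFin.
have wt2 : 0 < w t / 2 by rewrite divr_gt0.
have /nbhs_ballP[d /= d0 hd] : \forall s \near t, w t / 2 <= w s.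
  by have := wc t => /cvgrPdist_le/(_ _ wt2); apply: filterS => s;
    rewrite ler_norml => /andP[_ h]; lra.
(* Truncation to [0, 1] keeps a < b even when t is an endpoint. *)
pose a := Num.max 0 (t - d / 2); pose b := Num.min 1 (t + d / 2).
have ab : a < b.
  by rewrite gt_max !lt_min; apply/andP; split; apply/andP; split; lra.
have sub : `[a, b] `<=` (`[0, 1] : set R).
  move=> s /=; rewrite !in_itv /= => /andP[h1 h2].
  have : 0 <= a by rewrite le_max lexx.
  have : b <= 1 by rewrite ge_min lexx.
  by move=> h3 h4; apply/andP; split; lra.
have mw01 := measurable_int _ wi.
have mwab := measurable_funS (measurable_itv _) sub mw01.
have : ((w t / 2)%:E * lebesgue_measure (`[a, b] : set R) <= 0)%E.
  rewrite -EI -integral_cst //.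
  apply: (@le_trans _ _ (\int[lebesgue_measure]_(x in `[a, b]) (w x)%:E)%E);
    last first.
    apply: ge0_subset_integral => //.
    by move=> x _; rewrite lee_fin.
  apply: ge0_le_integral => //.
  - by move=> x _; rewrite lee_fin ltW.
  - move=> s /=; rewrite in_itv /= => /andP[h1 h2]; rewrite lee_fin; apply: hd.
    have : t - d / 2 <= a by rewrite le_max lexx orbT.
    have : b <= t + d / 2 by rewrite ge_min lexx orbT.
    move=> h3 h4; rewrite -ball_normE /= ltr_norml; apply/andP; split; lra.
rewrite lebesgue_measure_itv /= lte_fin ab -EFinB -EFinM lee_fin leNgt.
by rewrite mulr_gt0 // subr_gt0.
Qed.

Lemma ham_vfM (f g : plane R -> R) p : smooth f -> smooth g ->
  ham_vf (fun q => f q * g q) p = f p *: ham_vf g p + g p *: ham_vf f p.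
Proof.
move=> fs gs.
have E v : 'D_v (fun q => f q * g q) p = f p * 'D_v g p + g p * 'D_v f p.
  by rewrite (deriveM (smooth_derivable fs) (smooth_derivable gs)).
by rewrite /ham_vf !E; congr pair; rewrite /= /GRing.scale //=; ring.
Qed.

Lemma bracketM (h f g : plane R -> R) p : smooth f -> smooth g ->
  bracket h (fun q => f q * g q) p = f p * bracket h g p + g p * bracket h f p.
Proof.
move=> fs gs; rewrite /bracket ham_vfM //.
move: (ham_vf h p) (ham_vf f p) (ham_vf g p) => u v w.
by rewrite /omega /= /GRing.scale /=; ring.
Qed.

(** The field of the second chart coordinate is the image of the horizontal direction, hence spans
    the tangent of C. Through the last clause, the derivative of a function h along c at s0 becomes
    a multiple of {h, y}. *)
Lemma defining_function (C : set (plane R)) (c : R -> plane R) s0 :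
  loop_param C c ->
  exists (y : plane R -> R) (B : set (plane R)), [/\ smooth y, nbhs (c s0) B,
    forall q, B q -> C q -> y q = 0 &
    exists l : R, derive1 c s0 = l *: ham_vf y (c s0)].
Proof.
move=> cP; have [cs _ _ _ cr] := cP.
have [sigma [tau [B [[ss ts] [sK tK] symp nB BC]]]] := loop_chart s0 cP.
exists (fun q => (tau q).2), B.
have ys : smooth (fun q => (tau q).2) by smth.
have yB q : B q -> C q -> (tau q).2 = 0 by move=> Bq /(BC _ Bq).
split => //.
have dt : differentiable tau (c s0) by exact: smooth_diff.
have dc : differentiable c s0 by exact: smooth_diff.
have dy : differentiable (fun q => (tau q).2) (c s0) by exact: smooth_diff.
have d2 : differentiable (fun q : plane R => q.2) (tau (c s0)) by apply:
  smooth_diff; smth.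
pose a := 'd tau (c s0) (derive1 c s0).
have a2 : a.2 = 0.
  rewrite -(derive_snd (tau (c s0))) (deriveE _ d2) -(diff_compE _ dt d2).
  rewrite derive1E (deriveE _ dc).
  have dyc : differentiable (fun s => (tau (c s)).2) s0 by exact:
    (differentiable_comp dc dy).
  rewrite -(diff_compE _ dc dy) -(deriveE _ dyc).
  apply: derive_cst_near.
  have cc : {for s0, continuous c} by exact: differentiable_continuous.
  have nc : \forall s \near s0, B (c s) by exact: cc nB.
  have C' s : C (c s) by rewrite -cr; exists s.
  by apply: filterS nc => s Bs; rewrite !yB //; exact: nbhs_singleton.
exists a.1.
have -> : derive1 c s0 = 'd sigma (tau (c s0)) a by rewrite /a diff_cancel.
have -> : ham_vf (fun q => (tau q).2) (c s0) = 'd sigma (tau (c s0)) (1, 0).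
  have s2 : smooth (fun q : plane R => q.2) by smth.
  have := ham_vf_conj ss ts sK tK symp (tau (c s0)) s2.
  by rewrite tK => ->; rewrite /ham_vf !derive_snd /= oppr0.
rewrite -linearZ; congr ('d sigma _ _).
rewrite [LHS]surjective_pairing a2; congr pair; first by rewrite [RHS]mulr1.
by rewrite /= [RHS]mulr0.
Qed.

(** Pigeonhole: k + 1 parameters in A at mutual distance less than 1 give k + 1 distinct points of
    C. *)
Lemma loop_not_finite (C : set (plane R)) (c : R -> plane R) (s0 : R) (k : nat)
  (x : 'I_k -> plane R) (A : set R) :
  loop_param C c -> nbhs s0 A -> exists2 s, A s & forall i, c s <> x i.
Proof.
move=> cP /nbhs_ballP[d /= d0 dA].
(* The bound e <= d keeps the parameters in A, and e <= 1 / 2 lets [loop_inj] separate them. *)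
pose e := Num.min d (1 / 2).
have e0 : 0 < e by rewrite lt_min d0 /=.
have ed : e <= d by rewrite ge_min lexx.
have e2 : e <= 1 / 2 by rewrite ge_min lexx orbT.
pose s (j : 'I_k.+1) : R := s0 + e * (j%:R / k.+1%:R).
have k0 : 0 < k.+1%:R :> R by rewrite ltr0n.
have j01 (j : 'I_k.+1) : 0 <= (j%:R / k.+1%:R : R) < 1.
  by rewrite divr_ge0 //= ltr_pdivrMr // mul1r ltr_nat ltn_ord.
have sA j : A (s j).
  apply: dA; rewrite -ball_normE /= /s opprD addNKr normrN.
  have /andP[h1 h2] := j01 j.
  by rewrite ger0_norm ?mulr_ge0 ?(ltW e0) // (lt_le_trans _ ed) // gtr_pMr.
have s_inj : injective (fun j => c (s j)).
  move=> i j /(loop_inj cP) E; have : s i = s j.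
    apply: E; have /andP[h1 h2] := j01 i; have /andP[h3 h4] := j01 j.
    have -> : s i - s j = e * (i%:R / k.+1%:R - j%:R / k.+1%:R) by rewrite /s;
      ring.
    move: h1 h2 h3 h4; move: (i%:R / k.+1%:R : R) (j%:R / k.+1%:R : R) =>
      u v h1 h2 h3 h4.
    rewrite normrM gtr0_norm //; apply: (@le_lt_trans _ _ e); last by lra.
    rewrite ler_piMr ?(ltW e0) // ltW // ltr_norml; apply/andP; split; lra.
  move=> /addrI/mulfI; rewrite gt_eqF // => /(_ isT)/mulIf.
  rewrite invr_eq0 gt_eqF // => /(_ isT)/eqP; rewrite eqr_nat => /eqP E';
    exact: val_inj.
apply: contrapT => nE.
have H j : exists i, c (s j) = x i.
  by apply: contrapT => nH; apply: nE; exists (s j) => // i E; apply: nH;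
    exists i.
have [f fE] := choice H.
have f_inj : injective f by move=> i j E; apply: s_inj; rewrite /= !fE E.
by have := leq_card f f_inj; rewrite !card_ord ltnn.
Qed.

(** Brackets are tested against the stabilizer algebra alone: these are the brackets that a
    polarizing algebra containing it controls. *)
Lemma polarizing_constant (k : nat) (P : pointed_vortex_loop R k) (Gamma :
  'I_k -> R)
  (h : plane R -> R) : smooth h ->
  (forall f, lie_algebra_of (curve_stabilizer P) f ->
     pvl_distribution P Gamma (bracket h f) = 0) ->
  forall p q, vl_curve P p -> vl_curve P q -> h p = h q.
Proof.
move=> hs hf.
set c := some_oriented_param P.
have [cP cpos] : oriented_param P (vl_form P) c by exact: some_oriented_paramP.
have [cs _ _ _ cr] := cP.
have PC s : vl_curve P (c s) by rewrite -cr; exists s.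
have dhc s : differentiable (fun s => h (c s)) s.
  by apply: (differentiable_comp (smooth_diff s cs)); exact: smooth_diff.
suff d0 s : 'D_1 (fun s => h (c s)) s = 0.
  move=> p q; rewrite -{1 2}cr => -[s _ <-] [t _ <-].
  apply: (@is_derive_0_is_cst _ (fun s => h (c s))) => u.
  by split; [exact: diff_derivable|].
apply/eqP/negP => /negP nz.
have [y [B [ys nB yB [l cl]]]] := defining_function s cP.
pose kk := bracket h y.
have kks : smooth kk by exact: smooth_bracket.
have kk0 : kk (c s) != 0.
  apply: contra_neq nz => kk0.
  have dc : differentiable c s by exact: smooth_diff.
  have dh : differentiable h (c s) by exact: smooth_diff.
  rewrite (deriveE _ (dhc s)) (diff_compE _ dc dh) -(deriveE _ dc) -derive1E cl.
  rewrite linearZ /= -omega_ham_vf // -[omega _ _]/(kk (c s)) kk0 scaler0 //.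
have [r r0 rB] := box_sub_nbhs nB.
have r20 : 0 < r / 2 by rewrite divr_gt0.
pose b := bump2 (c s) (r / 2).
have bs : smooth b by exact: smooth_bump2.
have bB q : b q != 0 -> box (c s) r q.
  by move=> bq; have := bump2_0 r20 bq; rewrite mulrC divfK.
(* The squared Euclidean distance to a marked point: a polynomial, whose zero removes the term of
   that point from the pairing whatever the sign of its vorticity. *)
pose m i (q : plane R) := (q.1 - (pvl_point P i).1) ^+ 2 +
  (q.2 - (pvl_point P i).2) ^+ 2.
have m0 i q : 0 <= m i q by rewrite addr_ge0 ?sqr_ge0.
pose mu (q : plane R) := \prod_i m i q.
have mus : smooth mu.
  have ms i : smooth (m i) by rewrite /m; under eq_fun do rewrite !expr2; smth.
  rewrite /mu; elim: (index_enum _) => [|i t IH].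
    under eq_fun do rewrite big_nil; exact: smooth_cst.
  by under eq_fun do rewrite big_cons; exact: smoothM.
have mu0 q : 0 <= mu q by exact: prodr_ge0.
pose g q := b q * mu q * kk q.
have gs : smooth g by apply: smoothM => //; exact: smoothM.
pose f q := g q * y q.
have fs : smooth f by exact: smoothM.
have fB q : f q != 0 -> box (c s) r q.
  by move=> fq; apply: bB; apply: contra_neq fq => b0; rewrite /f /g b0 !mul0r.
have fT : test_function f by apply:
  (test_functionS fs (@compact_box _ (c s) r)).
have fP q : vl_curve P q -> f q = 0.
  move=> Pq; have [bq|bq] := eqVneq (b q) 0; first by rewrite /f /g bq !mul0r.
  by rewrite /f (yB q (rB _ (bB _ bq)) Pq) mulr0.
(* Inside the box y = 0 on C, so the Leibniz rule leaves only g {h, y}; at a point outside the box f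
   vanishes on a neighbourhood. *)
have brE q : vl_curve P q -> bracket h f q = b q * mu q * kk q ^+ 2.
  move=> Pq; have [qb|qb] := pselect (box (c s) r q).
    by rewrite /f bracketM // (yB q (rB _ qb) Pq) mul0r addr0 -/kk /g expr2
      mulrA.
  have -> : b q = 0 by apply/eqP; apply: contra_notT qb; exact: bB.
  have E v : 'D_v f q = 0.
    apply/eqP; apply: contra_notT qb;
      exact: (derive_neq0_compact (@compact_box _ (c s) r) fB).
  by rewrite /bracket /ham_vf !E oppr0 /omega !mulr0 subrr !mul0r.
have br_ge0 q : vl_curve P q -> 0 <= bracket h f q.
  by move=> Pq; rewrite brE // mulr_ge0 ?sqr_ge0 // mulr_ge0 // bump2_ge0.
have Lf : lie_algebra_of (curve_stabilizer P) f.
  by apply/(stabilizer_lie_algebraP cP); split => // p q Pp Pq; rewrite !fP.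
have := hf f Lf; rewrite /= /pvl_pairing [X in _ + X]big1; last first.
  move=> i _; have [c' [t' [[c'P _] xi _ _]]] := pvl_consecutive P.
  have Px : vl_curve P (pvl_point P i) by have [_ _ _ _ <-] := c'P; rewrite xi;
    exists (t' i).
  rewrite brE // /mu (bigD1 i) //= {1}/m !subrr expr0n /= add0r.
  by rewrite !(mul0r, mulr0).
rewrite addr0 /loop_integral -/c => I0.
pose w t := bracket h f (c t) * vl_form P (c t) (derive1 c t).
have wc : continuous w.
  apply: smooth_continuous; apply: smoothM.
    by apply: (smooth_comp fin_basis_plane cs); exact: smooth_bracket.
  by apply: form_smooth cs _; [exact: vl_one_form|rewrite -cr].
have w0 t : 0 <= w t by rewrite mulr_ge0 ?br_ge0 // ltW.
have wz := Rintegral01_eq0 wc w0 I0.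
have brz q : vl_curve P q -> bracket h f q = 0.
  move=> Pq; have [t /andP[t0 t1] <-] := loop_window cP 0 Pq.
  have t01 : 0 <= t <= 1 by rewrite t0 /= ltW // -[1]add0r.
  have /eqP := wz t t01; rewrite mulf_eq0 => /orP[/eqP//|/eqP E].
  by have := cpos t; rewrite E ltxx.
have nA : \forall t \near s, b (c t) = 1 /\ kk (c t) != 0.
  have cc : {for s, continuous c} by exact: smooth_continuous.
  have nb : \forall q \near c s, b q = 1.
    apply/nbhs_ballP; exists (r / 2) => //= q; rewrite -ball_normE /= distrC =>
      /ltW.
    exact: bump2_1.
  have nk : \forall q \near c s, kk q != 0.
    have kc : {for c s, continuous kk} by exact: smooth_continuous.
    have k0 : 0 < `|kk (c s)| by rewrite normr_gt0.
    move/cvgrPdist_lt : kc => /(_ _ k0); apply: filterS => q.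
    by apply: contraTneq => ->; rewrite subr0 ltxx.
  have nb' : \forall t \near s, b (c t) = 1 by exact: cc nb.
  have nk' : \forall t \near s, kk (c t) != 0 by exact: cc nk.
  by near=> t; split; near: t.
(* The point c s may itself be marked, and then mu vanishes there; a nearby parameter avoids all
   marked points while b = 1 and {h, y} is still nonzero. *)
have [t [b1 kt] xt] := loop_not_finite (pvl_point P) cP nA.
have := brz (c t) (PC t); rewrite brE // b1 mul1r => /eqP.
rewrite mulf_eq0 sqrf_eq0 (negbTE kt) orbF => /eqP mut.
have /prodf_neq0 : forall i, true -> m i (c t) != 0.
  move=> i _; apply/eqP => /eqP; rewrite paddr_eq0 ?sqr_ge0 // !sqrf_eq0
    !subr_eq0.
  move=> /andP[/eqP h1 /eqP h2]; apply: (xt i).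
  by rewrite [LHS]surjective_pairing [RHS]surjective_pairing h1 h2.
by rewrite -/(mu (c t)) mut eqxx.
Unshelve. all: by end_near. Qed.
End Maximality.

Theorem proposition3p15 (R : realType) (k : nat)
  (P : pointed_vortex_loop R k) (Gamma : 'I_k -> R)
  (Gamma_neq0 : forall i, Gamma i != 0) :
  polarization_subgroup (pvl_distribution P Gamma) (curve_stabilizer P).
Proof.
have [cP cpos] := some_oriented_paramP P.
set c := some_oriented_param P in cP cpos.
have [_ _ _ _ cr] := cP.
split.
- exact: stabilizer_subgroup.
- exact: stabilizer_lie_subalgebra cP.
- move=> g h /(stabilizer_lie_algebraP cP)[[gs gc] gC] /(stabilizer_lie_algebraP
    cP)[[hs hc] hC].
  have br0 q : vl_curve P q -> bracket g h q = 0 by exact: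
    (bracket_constant cP).
  rewrite /= /pvl_pairing big1 ?addr0; last first.
    (* The parametrization that orders the marked points may differ from [c]; here it places them on
       the curve. *)
    move=> i _; have [c' [t' [[c'P _] xi _ _]]] := pvl_consecutive P.
    by rewrite br0 ?mulr0 // xi; have [_ _ _ _ <-] := c'P; exists (t' i).
  rewrite /loop_integral -/c; under eq_Rintegral.
    move=> t _; rewrite br0; last by rewrite -cr; exists t.
    rewrite mul0r; over.
  by rewrite /Rintegral integral0.
- move=> l [lsub _ _ _] lpol Ll; apply/seteqP; split => // h lh.
  apply/(stabilizer_lie_algebraP cP); split; first exact: lsub.
  have [hs _] := lsub h lh.
  apply: (polarizing_constant (Gamma := Gamma) hs) => f /Ll lf.
  exact: lpol.
Qed.
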